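(* Let $W\in\{\mathrm{A}_{\frac12\infty},\mathrm{D}_{\frac12\infty}\}$, let $C_W$ be the set of critical points of $f_W:\mathbb{C}^2\to\mathbb{C}$, and put $C_{W,0}=C_W\cap f_W^{-1}(0)$, $C_{W,1}=C_W\cap f_W^{-1}(1)$. Then: (i) $C_W\subset\mathbb{R}^2$; (ii) at every critical point the Hessian of $f_W|_{\mathbb{R}^2}$ is non-degenerate; it is indefinite at points of $C_{W,0}$ and negative definite at points of $C_{W,1}$; (iii) $C_{W,0}$ is exactly the set of nodes of the real curve $X_{W,0,\mathbb{R}}:=\mathbb{R}^2\cap f_W^{-1}(0)$, and the map $c\mapsto B_c:=$ (the bounded connected component of $\mathbb{R}^2\setminus X_{W,0,\mathbb{R}}$ containing $c$) is a bijection from $C_{W,1}$ onto the set of bounded connected components of $\mathbb{R}^2\setminus X_{W,0,\mathbb{R}}$.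
   Context: Let $s(x)=\frac{\sin\sqrt{x}}{\sqrt{x}}=\prod_{n\ge1}\big(1-\frac{x}{n^2\pi^2}\big)$ and $c(x)=\cos\sqrt{x}=\prod_{n\ge1}\big(1-\frac{4x}{(2n-1)^2\pi^2}\big)$. Define $f_{\mathrm{A}_{\frac12\infty}}(x,y)=xs(x)^2-y^2$ and $f_{\mathrm{D}_{\frac12\infty}}(x,y)=xs(x)^2-xy^2$ on $\mathbb{C}^2$; they are real on $\mathbb{R}^2$. A node of the real curve $X_{W,0,\mathbb{R}}$ is a point of it at which two local smooth irreducible branches cross transversally. *)

(* Defs.v *)
From Stdlib Require Import Reals Factorial.
From Coquelicot Require Import Coquelicot.
Open Scope R_scope.

Fixpoint cpow (z : C) (n : nat) : C :=
  match n with O => RtoC 1 | S m => Cmult z (cpow z m) end.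

(* Taylor coefficients of s(x) = sin(sqrt x)/sqrt x = sum_k (-1)^k x^k/(2k+1)! *)
Definition s_coef (k : nat) : R := (-1) ^ k / INR (fact (2 * k + 1)).

(* the entire function s on C, as the (absolutely convergent) power series,
   taken componentwise *)
Definition s (z : C) : C :=
  (Series (fun k => s_coef k * Re (cpow z k)),
   Series (fun k => s_coef k * Im (cpow z k))).

Inductive W := W_A | W_D.

Definition fW (w : W) (x y : C) : C :=
  match w with
  | W_A => Cminus (Cmult x (Cmult (s x) (s x))) (Cmult y y)
  | W_D => Cminus (Cmult x (Cmult (s x) (s x))) (Cmult x (Cmult y y))
  end.

Definition critical (w : W) (x y : C) : Prop :=
  @is_derive C_AbsRing C_NormedModule (fun t => fW w t y) x (RtoC 0) /\
  @is_derive C_AbsRing C_NormedModule (fun t => fW w x t) y (RtoC 0).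

(* restriction of f_W to R^2 (real-valued there) *)
Definition fR (w : W) (x y : R) : R := Re (fW w (RtoC x) (RtoC y)).

Definition hxx w a b := Derive (fun t => Derive (fun u => fR w u b) t) a.
Definition hyy w a b := Derive (fun t => Derive (fun u => fR w a u) t) b.
Definition hxy w a b := Derive (fun t => Derive (fun u => fR w u t) a) b.
Definition hyx w a b := Derive (fun t => Derive (fun u => fR w t u) b) a.

Definition hess_form w a b (v1 v2 : R) : R :=
  hxx w a b * v1 * v1 + hxy w a b * v1 * v2 + hyx w a b * v2 * v1
  + hyy w a b * v2 * v2.

Definition hess_nondegenerate w a b : Prop :=
  hxx w a b * hyy w a b - hxy w a b * hyx w a b <> 0.
Definition hess_indefinite w a b : Prop :=
  (exists v1 v2, hess_form w a b v1 v2 > 0) /\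
  (exists v1 v2, hess_form w a b v1 v2 < 0).
Definition hess_negdef w a b : Prop :=
  forall v1 v2, (v1, v2) <> (0, 0) -> hess_form w a b v1 v2 < 0.

Definition XR (w : W) (p : R * R) : Prop := fR w (fst p) (snd p) = 0.

Definition dist2 (p q : R * R) : R :=
  sqrt ((fst p - fst q)^2 + (snd p - snd q)^2).

Definition smooth_branch (eps : R) (g1 g2 : R -> R) (p : R * R) : Prop :=
  (forall n t, Rabs t < eps -> ex_derive_n g1 n t /\ ex_derive_n g2 n t) /\
  (g1 0, g2 0) = p /\
  (forall t, Rabs t < eps -> (Derive g1 t, Derive g2 t) <> (0, 0)) /\
  (forall t t', Rabs t < eps -> Rabs t' < eps -> (g1 t, g2 t) = (g1 t', g2 t') -> t = t').

Definition is_node (X : R * R -> Prop) (p : R * R) : Prop :=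
  X p /\
  exists eps r (g1 g2 h1 h2 : R -> R),
    0 < eps /\ 0 < r /\
    smooth_branch eps g1 g2 p /\ smooth_branch eps h1 h2 p /\
    Derive g1 0 * Derive h2 0 - Derive g2 0 * Derive h1 0 <> 0 /\
    forall q, dist2 q p < r ->
      (X q <-> exists t, Rabs t < eps /\
                 (q = (g1 t, g2 t) \/ q = (h1 t, h2 t))).

Definition open2 (U : R * R -> Prop) : Prop :=
  forall p, U p -> exists r, 0 < r /\ forall q, dist2 q p < r -> U q.

Definition connected2 (A : R * R -> Prop) : Prop :=
  ~ exists U V, open2 U /\ open2 V /\
      (forall p, A p -> U p \/ V p) /\
      (forall p, A p -> U p -> V p -> False) /\
      (exists p, A p /\ U p) /\ (exists p, A p /\ V p).

Definition component (S : R * R -> Prop) (c : R * R) (p : R * R) : Prop :=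
  exists A, connected2 A /\ (forall q, A q -> S q) /\ A c /\ A p.

Definition bounded2 (B : R * R -> Prop) : Prop :=
  exists M, forall p, B p -> Rabs (fst p) <= M /\ Rabs (snd p) <= M.

Definition set_eq (A B : R * R -> Prop) : Prop := forall p, A p <-> B p.

Definition complementX (w : W) (p : R * R) : Prop := ~ XR w p.

Definition bounded_component (w : W) (B : R * R -> Prop) : Prop :=
  (exists c, complementX w c /\ set_eq B (component (complementX w) c)) /\
  bounded2 B.

(* Main.v *)
(* Writing x = u^2 one has x s(x)^2 = sin^2 u, and (x s^2)' = s c. For w = a + i b, the function
   t |-> c((tw)^2) + i t w s((tw)^2) solves F' = i w F, so it is exp(i w t); hence the zeros of s
   and c are squares of nonzero real zeros of sin and cos, and the critical points are explicit:
   y = 0 and s c = 0, together with (0, 1) and (0, -1) in type D.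
   On R^2 one has f = q(x) (h(x) - y^2) with h = x s^2, q = 1 (type A) or h = s^2, q = x (type D).
   A node has two independent tangents, so the gradient of f vanishes there; conversely the two
   branches are y = +- sin u with x = u^2 (type A), y = +- s(x) (type D), or x = 0 and the graph of s or -s.
   The sets (n pi)^2 < x < ((n+1) pi)^2, y^2 < h(x) are connected, and clopen in the complement
   of the curve, and each contains exactly one critical point of value 1; any other point of the
   complement can be joined to infinity by a vertical ray, or by going to the x-axis
   and then along the negative half of it. *)
Require Import Defs.
From Stdlib Require Import Reals Factorial ZArith Lra Lia Classical.
From Coquelicot Require Import Coquelicot.
Open Scope R_scope.

(** * Complex derivatives and everywhere convergent power series *)

(** Reality of the zeros is a comparison of moduli. A zero of s or c at w^2, with w = a + i b, makes
    exp(i w) and exp(-i w) agree up to sign; their moduli are exp(-b) and exp(b), so b = 0. This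
    needs Euler's formula at complex w, whereas s is given only by two real series; hence the
    calculus of derivatives of power series below. The Hessian signs rest on two identities. By c =
    s + 2 x s', the entry f_xx = s' c - s^2/2 equals 2 x s'^2 at a zero of s; by c^2 + x s^2 = 1,
    the functions s and c have no common positive zero and the critical values are 0 and 1. The
    regions are clopen in the complement because h vanishes at both ends of a strip, except at x = 0
    in type D, where the factor q removes the whole line x = 0. *)

(* A remainder that is O(|h|^2) on every disk: stronger than differentiability, and stable under
   sums, products and compositions without any choice of epsilon. *)
Definition cderiv (f : C -> C) (z l : C) : Prop :=
  forall r, exists M, 0 <= M /\ forall h, Cmod h <= r ->
    Cmod (f (z + h) - f z - l * h)%C <= M * Cmod h ^ 2.

Lemma cderiv_is_derive (f : C -> C) (z l : C) :
  cderiv f z l -> @is_derive C_AbsRing C_NormedModule f z l.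
Proof.
  intros H. split.
  - apply (@is_linear_scal_l C_AbsRing C_NormedModule).
  - intros x Hx. apply (@is_filter_lim_locally_unique C_AbsRing (AbsRing_NormedModule C_AbsRing)) in Hx. subst x.
    intros eps.
    destruct (H 1) as [M [HM HMh]].
    (* The 1 selects the disk on which M is valid; M + 1 avoids dividing by zero when M = 0. *)
    assert (Hd : 0 < Rmin 1 (eps / (M + 1))).
    { apply Rmin_pos; [lra|]. apply Rdiv_lt_0_compat; [apply eps|lra]. }
    cut (forall y : C, Cmod (y - z)%C < Rmin 1 (eps / (M + 1)) ->
      Cmod ((f y - f z) - ((y - z) * l))%C <= eps * Cmod (y - z)%C).
    { intros K. exists (mkposreal _ Hd). exact K. }
    intros y Hy.
    set (h := (y - z)%C) in *.
    assert (Hh1 : Cmod h <= 1) by (left; apply Rlt_le_trans with (1 := Hy); apply Rmin_l).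
    assert (Hh2 : Cmod h <= eps / (M + 1)) by (left; apply Rlt_le_trans with (1 := Hy); apply Rmin_r).
    specialize (HMh h Hh1).
    replace (z + h)%C with y in HMh by (unfold h; ring).
    replace (f y - f z - h * l)%C with (f y - f z - l * h)%C by ring.
    apply Rle_trans with (1 := HMh).
    assert (Hp := Cmod_ge_0 h).
    replace (M * Cmod h ^ 2) with ((M * Cmod h) * Cmod h) by ring.
    apply Rmult_le_compat_r; [exact Hp|].
    apply Rle_trans with ((M + 1) * Cmod h); [nra|].
    apply Rle_trans with ((M + 1) * (eps / (M + 1))); [apply Rmult_le_compat_l; lra|].
    right; field; lra.
Qed.

Lemma is_derive_of_quadratic (f : R -> R) (x l M : R) :
  (forall h, Rabs h <= 1 -> Rabs (f (x + h) - f x - l * h) <= M * h ^ 2) ->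
  is_derive f x l.
Proof.
  intros H. apply is_derive_Reals. intros eps Heps.
  assert (HM : 0 <= M).
  (* At h = 1 the bound reads |...| <= M, so M is nonnegative. *)
  { specialize (H 1). rewrite Rabs_R1 in H. specialize (H (Rle_refl 1)).
    assert (K := Rabs_pos (f (x + 1) - f x - l * 1)). lra. }
  assert (Hd : 0 < Rmin 1 (eps / (M + 1))).
  { apply Rmin_pos; [lra|]. apply Rdiv_lt_0_compat; lra. }
  exists (mkposreal _ Hd). simpl. intros h Hh0 Hh.
  assert (Hh1 : Rabs h <= 1) by (left; apply Rlt_le_trans with (1 := Hh); apply Rmin_l).
  assert (Hh2 : Rabs h < eps / (M + 1)) by (apply Rlt_le_trans with (1 := Hh); apply Rmin_r).
  specialize (H h Hh1).
  replace ((f (x + h) - f x) / h - l) with ((f (x + h) - f x - l * h) / h) by (field; lra).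
  rewrite Rabs_div by lra.
  assert (Hp : 0 < Rabs h) by (apply Rabs_pos_lt; lra).
  rewrite <- (pow2_abs h) in H.
  apply Rle_lt_trans with (M * Rabs h).
  - apply Rmult_le_reg_r with (Rabs h); [lra|].
    unfold Rdiv. rewrite Rmult_assoc, Rinv_l by lra. lra.
  - apply Rle_lt_trans with ((M + 1) * Rabs h); [nra|].
    replace eps with ((M + 1) * (eps / (M + 1))) by (field; lra).
    apply Rmult_lt_compat_l; lra.
Qed.

Lemma im_le_Cmod (z : C) : Rabs (Im z) <= Cmod z.
Proof.
  apply Rle_trans with (2 := Rmax_Cmod z). apply Rmax_r.
Qed.

Lemma cderiv_Re (f : C -> C) (t : R) (l : C) :
  cderiv f (RtoC t) l -> is_derive (fun u => Re (f (RtoC u))) t (Re l).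
Proof.
  intros H. destruct (H 1) as [M [_ HM]].
  apply is_derive_of_quadratic with M. intros h Hh.
  specialize (HM (RtoC h)). rewrite Cmod_R, pow2_abs in HM.
  apply Rle_trans with (2 := HM Hh). rewrite RtoC_plus.
  apply Rle_trans with (2 := re_le_Cmod _). right. f_equal. unfold Re, Im; simpl; ring.
Qed.

Lemma cderiv_Im (f : C -> C) (t : R) (l : C) :
  cderiv f (RtoC t) l -> is_derive (fun u => Im (f (RtoC u))) t (Im l).
Proof.
  intros H. destruct (H 1) as [M [_ HM]].
  apply is_derive_of_quadratic with M. intros h Hh.
  specialize (HM (RtoC h)). rewrite Cmod_R, pow2_abs in HM.
  apply Rle_trans with (2 := HM Hh). rewrite RtoC_plus.
  apply Rle_trans with (2 := im_le_Cmod _). right. f_equal. unfold Re, Im; simpl; ring.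
Qed.

Lemma cderiv_const (k z : C) : cderiv (fun _ => k) z 0.
Proof.
  intros r. exists 0. split; [lra|]. intros h _.
  replace (k - k - 0 * h)%C with (RtoC 0) by ring. rewrite Cmod_0. lra.
Qed.

Lemma cderiv_id (z : C) : cderiv (fun t => t) z 1.
Proof.
  intros r. exists 0. split; [lra|]. intros h _.
  replace (z + h - z - 1 * h)%C with (RtoC 0) by ring. rewrite Cmod_0. lra.
Qed.

Lemma cderiv_eq (f g : C -> C) (z l m : C) :
  cderiv f z l -> (forall t, f t = g t) -> l = m -> cderiv g z m.
Proof.
  intros H E <- r. destruct (H r) as [M HM]. exists M.
  split; [apply HM|]. intros h Hh. rewrite <- !E. now apply HM.
Qed.

Lemma cderiv_plus (f g : C -> C) (z l m : C) :
  cderiv f z l -> cderiv g z m -> cderiv (fun t => (f t + g t)%C) z (l + m)%C.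
Proof.
  intros Hf Hg r. destruct (Hf r) as [M [HM Hf']], (Hg r) as [N [HN Hg']].
  exists (M + N). split; [lra|]. intros h Hh.
  specialize (Hf' h Hh). specialize (Hg' h Hh).
  match goal with |- Cmod ?e <= _ =>
    replace e with ((f (z + h) - f z - l * h) + (g (z + h) - g z - m * h))%C by ring end.
  apply Rle_trans with (1 := Cmod_triangle _ _). lra.
Qed.

(** The increment is l h plus a remainder of size at most M |h|^2 <= M r |h|. This linear bound
    controls the cross terms in products and compositions. *)
Lemma cderiv_lipschitz (f : C -> C) (z l : C) (r : R) :
  cderiv f z l -> exists L, 0 <= L /\
    forall h, Cmod h <= r -> Cmod (f (z + h) - f z)%C <= L * Cmod h.
Proof.
  intros H. destruct (H r) as [M [HM Hh]].
  exists (Cmod l + M * Rabs r). split.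
  - assert (A := Cmod_ge_0 l). assert (B := Rabs_pos r). nra.
  - intros h Hr. specialize (Hh h Hr).
    replace (f (z + h) - f z)%C with (l * h + (f (z + h) - f z - l * h))%C by ring.
    apply Rle_trans with (1 := Cmod_triangle _ _). rewrite Cmod_mult.
    assert (A := Cmod_ge_0 h). assert (B := Rle_abs r).
    assert (M * Cmod h ^ 2 <= M * (Rabs r * Cmod h)); [|lra].
    apply Rmult_le_compat_l; [lra|]. simpl. rewrite Rmult_1_r.
    apply Rmult_le_compat_r; lra.
Qed.

Lemma cderiv_mult (f g : C -> C) (z l m : C) :
  cderiv f z l -> cderiv g z m ->
  cderiv (fun t => (f t * g t)%C) z (l * g z + f z * m)%C.
Proof.
  intros Hf Hg r.
  destruct (cderiv_lipschitz f z l r Hf) as [L [HL HLh]].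
  destruct (cderiv_lipschitz g z m r Hg) as [K [HK HKh]].
  destruct (Hf r) as [M [HM Hf']], (Hg r) as [N [HN Hg']].
  exists (M * Cmod (g z) + Cmod (f z) * N + L * K).
  assert (A := Cmod_ge_0 (f z)). assert (B := Cmod_ge_0 (g z)).
  split; [assert (0 <= L * K) by nra; nra|]. intros h Hh.
  specialize (Hf' h Hh). specialize (Hg' h Hh).
  specialize (HLh h Hh). specialize (HKh h Hh).
  (* Each remainder is multiplied by a value of the other function; the product of the two
     increments is quadratic in h by the Lipschitz bounds. *)
  match goal with |- Cmod ?e <= _ =>
    replace e with ((f (z + h) - f z - l * h) * g z + f z * (g (z + h) - g z - m * h)
       + (f (z + h) - f z) * (g (z + h) - g z))%C by ring end.
  apply Rle_trans with (1 := Cmod_triangle _ _).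
  assert (X := Cmod_triangle ((f (z + h) - f z - l * h) * g z)%C (f z * (g (z + h) - g z - m * h))%C).
  rewrite !Cmod_mult in X. rewrite Cmod_mult.
  assert (X1 : Cmod (f (z + h) - f z - l * h)%C * Cmod (g z) <= M * Cmod h ^ 2 * Cmod (g z))
    by (apply Rmult_le_compat_r; lra).
  assert (X2 : Cmod (f z) * Cmod (g (z + h) - g z - m * h)%C <= Cmod (f z) * (N * Cmod h ^ 2))
    by (apply Rmult_le_compat_l; lra).
  assert (X3 : Cmod (f (z + h) - f z)%C * Cmod (g (z + h) - g z)%C <= (L * Cmod h) * (K * Cmod h))
    by (apply Rmult_le_compat; try apply Cmod_ge_0; assumption).
  lra.
Qed.

Lemma cderiv_comp (f g : C -> C) (z l m : C) :
  cderiv f (g z) l -> cderiv g z m -> cderiv (fun t => f (g t)) z (l * m)%C.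
Proof.
  intros Hf Hg r.
  destruct (cderiv_lipschitz g z m r Hg) as [K [HK HKh]].
  destruct (Hg r) as [N [HN Hg']].
  (* The increment of g over the disk of radius r stays in a disk of radius K |r|, so this is where
     the remainder of f must be controlled. *)
  destruct (Hf (K * Rabs r)) as [M [HM Hf']].
  exists (M * K ^ 2 + Cmod l * N).
  assert (A := Cmod_ge_0 l).
  split; [assert (0 <= K ^ 2) by nra; nra|]. intros h Hh.
  specialize (Hg' h Hh). specialize (HKh h Hh).
  set (k := (g (z + h) - g z)%C) in *.
  assert (P := Cmod_ge_0 h). assert (Q := Cmod_ge_0 k). assert (B := Rle_abs r).
  assert (Hk : Cmod k <= K * Rabs r).
  { apply Rle_trans with (1 := HKh). apply Rmult_le_compat_l; lra. }
  specialize (Hf' k Hk).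
  replace (g z + k)%C with (g (z + h)%C) in Hf' by (unfold k; ring).
  match goal with |- Cmod ?e <= _ =>
    replace e with ((f (g (z + h)%C) - f (g z) - l * k) + l * (k - m * h))%C by ring end.
  apply Rle_trans with (1 := Cmod_triangle _ _). rewrite Cmod_mult.
  assert (X1 : Cmod k ^ 2 <= (K * Cmod h) ^ 2) by (apply pow_incr; lra).
  assert (X2 : M * Cmod k ^ 2 <= M * (K * Cmod h) ^ 2) by (apply Rmult_le_compat_l; lra).
  assert (X3 : Cmod l * Cmod (k - m * h)%C <= Cmod l * (N * Cmod h ^ 2))
    by (apply Rmult_le_compat_l; lra).
  lra.
Qed.

(** The derivative k z^(k-1) of the k-th power, indexed like [cpow] so that termwise differentiation
    keeps the same coefficients. *)
Definition dpow (z : C) (k : nat) : C :=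
  match k with O => RtoC 0 | S m => (RtoC (INR k) * cpow z m)%C end.

Lemma Cmod_cpow (z : C) (k : nat) : Cmod (cpow z k) = Cmod z ^ k.
Proof.
  induction k as [|k IH]; simpl; [apply Cmod_1|]. now rewrite Cmod_mult, IH.
Qed.

Lemma mult_dpow (z : C) (k : nat) : (z * dpow z k = RtoC (INR k) * cpow z k)%C.
Proof.
  destruct k as [|k]; [simpl; ring|]. unfold dpow. simpl cpow. ring.
Qed.

Lemma INR_le_pow2 (k : nat) : INR k <= 2 ^ k.
Proof.
  induction k as [|k IH]; [simpl; lra|].
  rewrite S_INR. simpl. assert (1 <= 2 ^ k) by (apply pow_R1_Rle; lra). lra.
Qed.

Lemma Cmod_dpow (z : C) (rho : R) (k : nat) :
  1 <= rho -> Cmod z <= rho -> Cmod (dpow z k) <= (2 * rho) ^ k.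
Proof.
  intros H1 Hz. destruct k as [|k].
  - simpl. rewrite Cmod_0. lra.
  - unfold dpow. rewrite Cmod_mult, Cmod_R, Cmod_cpow, Rabs_pos_eq by apply pos_INR.
    rewrite Rpow_mult_distr.
    assert (Cmod z ^ k <= rho ^ k) by (apply pow_incr; split; [apply Cmod_ge_0|exact Hz]).
    assert (rho ^ k <= rho ^ S k) by (apply Rle_pow; [lra|lia]).
    apply Rmult_le_compat; [apply pos_INR|apply pow_le, Cmod_ge_0|apply INR_le_pow2|lra].
Qed.

(** The remainders satisfy R_(k+1) = (z + h) R_k + k z^(k-1) h^2. The ratio 4 rho is generous: the
    induction only needs rho + 1 <= 4 rho, and any geometric growth is harmless against the
    coefficients. *)
Lemma cpow_remainder (z h : C) (rho : R) (k : nat) :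
  1 <= rho -> Cmod z <= rho -> Cmod (z + h) <= rho ->
  Cmod (cpow (z + h) k - cpow z k - dpow z k * h)%C <= (4 * rho) ^ k * Cmod h ^ 2.
Proof.
  intros H1 Hz Hh. induction k as [|k IH].
  - simpl. replace (1 - 1 - 0 * h)%C with (RtoC 0) by ring. rewrite Cmod_0.
    assert (X := Cmod_ge_0 h). nra.
  - match goal with |- Cmod ?e <= _ =>
      replace e with ((z + h) * (cpow (z + h) k - cpow z k - dpow z k * h) + dpow z k * (h * h))%C end.
    2:{ assert (E := mult_dpow z k). unfold dpow at 3. simpl cpow. rewrite S_INR, RtoC_plus.
        transitivity ((z + h) * (cpow (z + h) k - cpow z k) - (z * dpow z k) * h)%C; [ring|].
        rewrite E. ring. }
    apply Rle_trans with (1 := Cmod_triangle _ _). rewrite !Cmod_mult.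
    assert (X1 := Cmod_dpow z rho k H1 Hz).
    assert (P := Cmod_ge_0 h).
    set (e := Cmod (cpow (z + h) k - cpow z k - dpow z k * h)%C) in *.
    assert (Q : 0 <= e) by apply Cmod_ge_0.
    assert (X2 : Cmod (z + h) * e <= rho * ((4 * rho) ^ k * Cmod h ^ 2))
      by (apply Rmult_le_compat; [apply Cmod_ge_0|exact Q|exact Hh|exact IH]).
    assert (X3 : (2 * rho) ^ k <= (4 * rho) ^ k) by (apply pow_incr; lra).
    assert (X4 : Cmod (dpow z k) * (Cmod h * Cmod h) <= (4 * rho) ^ k * (Cmod h * Cmod h))
      by (apply Rmult_le_compat_r; nra).
    assert (X5 : 0 <= (4 * rho) ^ k) by (apply pow_le; lra).
    assert (X6 : 0 <= (4 * rho) ^ k * Cmod h ^ 2) by nra.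
    change ((4 * rho) ^ S k) with (4 * rho * (4 * rho) ^ k).
    nra.
Qed.

(** With [u = cpow z] and [a = s_coef] this is [s z] by conversion. A general sequence [u] lets the
    derivative and the Taylor remainder be series of the same kind. *)
Definition CSer (a : nat -> R) (u : nat -> C) : C :=
  (Series (fun k => a k * Re (u k)), Series (fun k => a k * Im (u k))).

(* Infinite radius of convergence. *)
Definition fast (a : nat -> R) : Prop :=
  forall r, 0 <= r -> ex_series (fun k => Rabs (a k) * r ^ k).

(** Enough growth control for absolute convergence against [fast] coefficients; the powers of z and
    their derivatives satisfy it. *)
Definition geom (u : nat -> C) : Prop :=
  exists B r, 0 <= B /\ 0 <= r /\ forall k, Cmod (u k) <= B * r ^ k.

Lemma fast_ex_series (a : nat -> R) (v : nat -> R) (B r : R) :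
  fast a -> 0 <= r -> (forall k, Rabs (v k) <= B * r ^ k) ->
  ex_series (fun k => Rabs (a k * v k)).
Proof.
  intros Ha Hr Hv.
  apply (ex_series_le (K := R_AbsRing) (V := R_CompleteNormedModule))
    with (fun k => B * (Rabs (a k) * r ^ k)).
  - intros k. change (Rabs (Rabs (a k * v k)) <= B * (Rabs (a k) * r ^ k)).
    rewrite Rabs_Rabsolu, Rabs_mult.
    assert (X := Rabs_pos (a k)). specialize (Hv k). nra.
  - apply (ex_series_scal_l B (fun k => Rabs (a k) * r ^ k)). now apply Ha.
Qed.

Lemma geom_ex_series (a : nat -> R) (u : nat -> C) :
  fast a -> geom u ->
  ex_series (fun k => Rabs (a k * Re (u k))) /\ ex_series (fun k => Rabs (a k * Im (u k))).
Proof.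
  intros Ha [B [r [HB [Hr Hu]]]].
  split; apply fast_ex_series with B r; trivial; intros k.
  - apply Rle_trans with (2 := Hu k), re_le_Cmod.
  - apply Rle_trans with (2 := Hu k), im_le_Cmod.
Qed.

Lemma CSer_ext (a b : nat -> R) (u v : nat -> C) :
  (forall k, (RtoC (a k) * u k = RtoC (b k) * v k)%C) -> CSer a u = CSer b v.
Proof.
  intros H. unfold CSer. f_equal; apply Series_ext; intros k; specialize (H k).
  - apply (f_equal Re) in H. simpl in H. unfold Re. lra.
  - apply (f_equal Im) in H. simpl in H. unfold Im. lra.
Qed.

Lemma CSer_plus (a : nat -> R) (u v : nat -> C) :
  fast a -> geom u -> geom v ->
  (CSer a (fun k => (u k + v k)%C) = CSer a u + CSer a v)%C.
Proof.
  intros Ha Hu Hv.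
  destruct (geom_ex_series a u Ha Hu) as [U1 U2].
  destruct (geom_ex_series a v Ha Hv) as [V1 V2].
  apply ex_series_Rabs in U1, U2, V1, V2.
  unfold CSer, Cplus. simpl. f_equal; rewrite <- Series_plus by assumption;
    apply Series_ext; intros k; unfold Re, Im; simpl; ring.
Qed.

Lemma CSer_scal (a : nat -> R) (u : nat -> C) (z : C) :
  fast a -> geom u -> (CSer a (fun k => (z * u k)%C) = z * CSer a u)%C.
Proof.
  intros Ha Hu.
  destruct (geom_ex_series a u Ha Hu) as [U1 U2].
  apply ex_series_Rabs in U1, U2.
  unfold CSer, Cmult. simpl. f_equal.
  - rewrite <- !Series_scal_l, <- Series_minus;
      [|now apply (ex_series_scal_l (fst z) (fun k => a k * Re (u k)))
       |now apply (ex_series_scal_l (snd z) (fun k => a k * Im (u k)))].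
    apply Series_ext; intros k; simpl; unfold Re, Im; ring.
  - rewrite <- !Series_scal_l, <- Series_plus;
      [|now apply (ex_series_scal_l (fst z) (fun k => a k * Im (u k)))
       |now apply (ex_series_scal_l (snd z) (fun k => a k * Re (u k)))].
    apply Series_ext; intros k; simpl; unfold Re, Im; ring.
Qed.

(** The factor 2 comes from bounding the real and imaginary parts separately. *)
Lemma CSer_bound (a : nat -> R) (u : nat -> C) (B r : R) :
  fast a -> 0 <= B -> 0 <= r -> (forall k, Cmod (u k) <= B * r ^ k) ->
  Cmod (CSer a u) <= 2 * (B * Series (fun k => Rabs (a k) * r ^ k)).
Proof.
  intros Ha HB Hr Hu.
  assert (Hg : geom u) by (exists B, r; auto).
  destruct (geom_ex_series a u Ha Hg) as [U1 U2].
  assert (K : forall v, (forall k, Rabs (v k) <= B * r ^ k) ->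
    ex_series (fun k => Rabs (a k * v k)) ->
    Rabs (Series (fun k => a k * v k)) <= B * Series (fun k => Rabs (a k) * r ^ k)).
  { intros v Hv Ev. apply Rle_trans with (1 := Series_Rabs _ Ev).
    rewrite <- Series_scal_l. apply Series_le.
    - intros k. split; [apply Rabs_pos|]. rewrite Rabs_mult.
      assert (X := Rabs_pos (a k)). specialize (Hv k). nra.
    - apply (ex_series_scal_l B (fun k => Rabs (a k) * r ^ k)). now apply Ha. }
  assert (K1 := K (fun k => Re (u k)) (fun k => Rle_trans _ _ _ (re_le_Cmod _) (Hu k)) U1).
  assert (K2 := K (fun k => Im (u k)) (fun k => Rle_trans _ _ _ (im_le_Cmod _) (Hu k)) U2).
  set (X := Series (fun k => a k * Re (u k))) in *.
  set (Y := Series (fun k => a k * Im (u k))) in *.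
  replace (CSer a u) with (RtoC X + Ci * RtoC Y)%C.
  - apply Rle_trans with (1 := Cmod_triangle _ _).
    rewrite Cmod_mult, Cmod_Ci, !Cmod_R. lra.
  - unfold CSer. fold X Y. apply injective_projections; simpl; ring.
Qed.

Lemma geom_cpow (z : C) : geom (cpow z).
Proof.
  exists 1, (Cmod z). split; [lra|]. split; [apply Cmod_ge_0|].
  intros k. rewrite Cmod_cpow. lra.
Qed.

Lemma geom_dpow (z : C) : geom (dpow z).
Proof.
  assert (X := Cmod_ge_0 z).
  exists 1, (2 * (1 + Cmod z)). split; [lra|]. split; [lra|].
  intros k. rewrite Rmult_1_l. apply Cmod_dpow; lra.
Qed.

Lemma geom_scal (u : nat -> C) (z : C) : geom u -> geom (fun k => (z * u k)%C).
Proof.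
  intros [B [r [HB [Hr Hu]]]]. assert (X := Cmod_ge_0 z).
  exists (Cmod z * B), r. split; [nra|]. split; [lra|]. intros k.
  rewrite Cmod_mult, Rmult_assoc. now apply Rmult_le_compat_l.
Qed.

(** By linearity the remainder of the series is the series of the remainders of the powers. These
    are at most |h|^2 (4 rho)^k, and |h|^2 factors out of the bound. *)
Lemma cderiv_CSer (a : nat -> R) (z : C) :
  fast a -> cderiv (fun t => CSer a (cpow t)) z (CSer a (dpow z)).
Proof.
  intros Ha r.
  (* One radius bounding both z and z + h for all |h| <= r, and at least 1 as [cpow_remainder]
     requires. *)
  set (rho := 1 + Cmod z + Rabs r).
  assert (P := Cmod_ge_0 z). assert (Q := Rabs_pos r). assert (Q' := Rle_abs r).
  assert (Hr : 1 <= rho) by (unfold rho; lra).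
  exists (Rabs (2 * Series (fun k => Rabs (a k) * (4 * rho) ^ k))). split.
  - apply Rabs_pos.
  - intros h Hh.
    assert (B := Cmod_ge_0 h).
    assert (Hzh : Cmod (z + h) <= rho).
    { apply Rle_trans with (1 := Cmod_triangle _ _). unfold rho. lra. }
    replace (CSer a (cpow (z + h)) - CSer a (cpow z) - CSer a (dpow z) * h)%C
      with (CSer a (fun k => (cpow (z + h) k + ((- (1)) * cpow z k + (- h) * dpow z k))%C)).
    2:{ assert (G1 := geom_cpow z). assert (G2 := geom_dpow z).
        rewrite CSer_plus; [|exact Ha|apply geom_cpow|].
        - rewrite (CSer_plus a (fun k => (- (1)) * cpow z k)%C (fun k => (- h) * dpow z k)%C);
            [|exact Ha|now apply geom_scal|now apply geom_scal].
          rewrite !CSer_scal by assumption. ring.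
        - destruct (geom_scal _ (- (1))%C G1) as [B1 [r1 [HB1 [Hr1 H1]]]].
          destruct (geom_scal _ (- h)%C G2) as [B2 [r2 [HB2 [Hr2 H2]]]].
          exists (B1 + B2), (r1 + r2). split; [lra|]. split; [lra|]. intros k.
          apply Rle_trans with (1 := Cmod_triangle _ _).
          specialize (H1 k). specialize (H2 k). simpl in H1, H2.
          assert (r1 ^ k <= (r1 + r2) ^ k) by (apply pow_incr; lra).
          assert (r2 ^ k <= (r1 + r2) ^ k) by (apply pow_incr; lra).
          nra. }
    apply Rle_trans with (2 * Series (fun k => Rabs (a k) * (4 * rho) ^ k) * Cmod h ^ 2);
      [|apply Rmult_le_compat_r; [apply pow2_ge_0|apply Rle_abs]].
    replace (2 * Series (fun k => Rabs (a k) * (4 * rho) ^ k) * Cmod h ^ 2)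
      with (2 * (Cmod h ^ 2 * Series (fun k => Rabs (a k) * (4 * rho) ^ k))) by ring.
    apply CSer_bound; [exact Ha|nra|lra|]. intros k.
    replace (cpow (z + h) k + (- (1) * cpow z k + - h * dpow z k))%C
      with (cpow (z + h) k - cpow z k - dpow z k * h)%C by ring.
    rewrite Rmult_comm. apply cpow_remainder; try lra. unfold rho; lra.
Qed.

(** * Euler's formula for s and c *)

Definition c_coef (k : nat) : R := (-1) ^ k / INR (fact (2 * k)).

(** The function c, that is, cos of a square root of z. *)
Definition cosq (z : C) : C := CSer c_coef (cpow z).

Definition ds (z : C) : C := CSer s_coef (dpow z).

(** Comparison with the exponential series, since m k >= k gives (m k)! >= k!. The free index [m]
    covers both 2k + 1 and 2k. *)
Lemma fast_alt_fact (m : nat -> nat) :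
  (forall k, (k <= m k)%nat) -> fast (fun k => (-1) ^ k / INR (fact (m k))).
Proof.
  intros Hm r Hr.
  apply (ex_series_le (K := R_AbsRing) (V := R_CompleteNormedModule))
    with (fun k => / INR (fact k) * r ^ k).
  - intros k. change (Rabs (Rabs ((-1) ^ k / INR (fact (m k))) * r ^ k) <= / INR (fact k) * r ^ k).
    assert (P : 0 < INR (fact k)) by apply INR_fact_lt_0.
    assert (Q : INR (fact k) <= INR (fact (m k))) by (apply le_INR, fact_le, Hm).
    assert (0 <= r ^ k) by now apply pow_le.
    rewrite Rabs_mult, Rabs_Rabsolu, (Rabs_pos_eq (r ^ k)) by assumption.
    apply Rmult_le_compat_r; [assumption|].
    rewrite Rabs_div by lra. rewrite pow_1_abs.
    rewrite Rabs_pos_eq by lra. unfold Rdiv. rewrite Rmult_1_l.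
    apply Rinv_le_contravar; lra.
  - exists (exp r). apply is_pseries_R. apply is_exp_Reals.
Qed.

Lemma fast_s : fast s_coef.
Proof. apply (fast_alt_fact (fun k => 2 * k + 1)%nat). intros; lia. Qed.

Lemma fast_c : fast c_coef.
Proof. apply (fast_alt_fact (fun k => 2 * k)%nat). intros; lia. Qed.

Lemma cderiv_s (z : C) : cderiv s z (ds z).
Proof. exact (cderiv_CSer s_coef z fast_s). Qed.

(** This is the derivative of sin u = u s(u^2) written at z = u^2. On coefficients it says c_k = (2k
    + 1) s_k; the factor z turns k z^(k-1) into k z^k, so no index is shifted. *)
Lemma cosq_s_ds (z : C) : cosq z = (s z + 2 * z * ds z)%C.
Proof.
  change (s z) with (CSer s_coef (cpow z)). unfold ds.
  rewrite <- CSer_scal; [|apply fast_s|apply geom_dpow].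
  rewrite <- CSer_plus; [|apply fast_s|apply geom_cpow|apply geom_scal, geom_dpow].
  apply CSer_ext. intros k.
  replace (cpow z k + 2 * z * dpow z k)%C with (cpow z k + 2 * (z * dpow z k))%C by ring.
  rewrite mult_dpow.
  replace (c_coef k) with (s_coef k * (1 + 2 * INR k)).
  - rewrite RtoC_mult, RtoC_plus, RtoC_mult. ring.
  - unfold c_coef, s_coef. rewrite Nat.add_1_r.
    change (fact (S (2 * k))) with (S (2 * k) * fact (2 * k))%nat.
    rewrite mult_INR, S_INR, mult_INR. simpl (INR 2).
    assert (X := INR_fact_lt_0 (2 * k)). assert (Y := pos_INR k).
    field. split; lra.
Qed.

(** On coefficients, (k + 1) c_(k+1) = - s_k / 2. The term of index 0 in the differentiated series
    vanishes, which allows the shift by one. *)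
Lemma cderiv_cosq (z : C) : cderiv cosq z (- (/ 2) * s z)%C.
Proof.
  apply cderiv_eq with (1 := cderiv_CSer c_coef z fast_c); [reflexivity|].
  change (s z) with (CSer s_coef (cpow z)).
  destruct (geom_ex_series c_coef (dpow z) fast_c (geom_dpow z)) as [U1 U2].
  apply ex_series_Rabs in U1, U2.
  assert (X : forall k, c_coef (S k) * INR (S k) = (-1/2) * s_coef k).
  { intros k. unfold c_coef, s_coef.
    replace (2 * S k)%nat with (S (S (2 * k))) by lia.
    replace (2 * k + 1)%nat with (S (2 * k)) by lia.
    set (n := S (2 * k)).
    change (fact (S n)) with (S n * fact n)%nat. rewrite mult_INR.
    assert (N : INR (S n) = 2 * INR (S k)).
    { unfold n. rewrite !S_INR, mult_INR. simpl. ring. }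
    rewrite N. assert (Y := INR_fact_lt_0 n). assert (Z := lt_0_INR (S k) ltac:(lia)).
    simpl pow. field. split; lra. }
  unfold CSer at 1.
  rewrite (Series_incr_1 _ U1), (Series_incr_1 _ U2).
  rewrite (Series_ext (fun k => c_coef (S k) * Re (dpow z (S k)))
    (fun k => (-1/2) * (s_coef k * Re (cpow z k)))).
  2:{ intros k. simpl (dpow z (S k)). rewrite <- Rmult_assoc, <- X. unfold Re, Im; simpl. ring. }
  rewrite (Series_ext (fun k => c_coef (S k) * Im (dpow z (S k)))
    (fun k => (-1/2) * (s_coef k * Im (cpow z k)))).
  2:{ intros k. simpl (dpow z (S k)). rewrite <- Rmult_assoc, <- X. unfold Re, Im; simpl. ring. }
  rewrite !Series_scal_l.
  replace (- (/ 2))%C with (RtoC (-1/2)).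
  2:{ apply injective_projections; simpl; field. }
  unfold CSer. apply injective_projections; simpl; unfold Re, Im; simpl; ring.
Qed.

Lemma CSer_0 (a : nat -> R) : fast a -> CSer a (cpow 0) = RtoC (a 0%nat).
Proof.
  intros Ha. destruct (geom_ex_series a (cpow 0) Ha (geom_cpow 0)) as [U1 U2].
  apply ex_series_Rabs in U1, U2.
  unfold CSer. rewrite (Series_incr_1 _ U1), (Series_incr_1 _ U2).
  rewrite (Series_ext (fun k => a (S k) * Re (cpow 0 (S k))) (fun k => 0 * a k)),
    (Series_ext (fun k => a (S k) * Im (cpow 0 (S k))) (fun k => 0 * a k)).
  - rewrite Series_scal_l. apply injective_projections; simpl; ring.
  - intros k. simpl. ring.
  - intros k. simpl. ring.
Qed.

Lemma s_0 : s 0 = 1%C.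
Proof.
  change (s 0) with (CSer s_coef (cpow 0)). rewrite CSer_0 by apply fast_s.
  f_equal. unfold s_coef. simpl. field.
Qed.

Lemma cosq_0 : cosq 0 = 1%C.
Proof.
  unfold cosq. rewrite CSer_0 by apply fast_c.
  f_equal. unfold c_coef. simpl. field.
Qed.

(** Stands for exp(i t w). The extra variable t makes it possible to integrate the differential
    equation along the real segment from 0 to 1 with w a fixed complex number. *)
Definition euler (w t : C) : C :=
  (cosq ((t * w) * (t * w)) + Ci * (t * w) * s ((t * w) * (t * w)))%C.

Lemma cderiv_euler (w t : C) : cderiv (euler w) t (Ci * w * euler w t)%C.
Proof.
  assert (L : cderiv (fun t => t * w)%C t w).
  { apply cderiv_eq with (1 := cderiv_mult _ _ _ _ _ (cderiv_id t) (cderiv_const w t));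
      [reflexivity|ring]. }
  assert (Q := cderiv_mult _ _ _ _ _ L L). simpl in Q.
  apply cderiv_eq with (1 := cderiv_plus _ _ _ _ _
    (cderiv_comp _ _ _ _ _ (cderiv_cosq _) Q)
    (cderiv_mult _ _ _ _ _ (cderiv_mult _ _ _ _ _ (cderiv_const Ci t) L)
       (cderiv_comp _ _ _ _ _ (cderiv_s _) Q))); [reflexivity|].
  cbv beta. unfold euler. rewrite cosq_s_ds.
  set (x := (t * w * (t * w))%C). set (A := s x). set (D := ds x).
  (* The derivative of c contributes - w (t w) s, read here as i i w (t w) s; that of i t w s
     contributes i w (s + 2 x s') = i w c. *)
  transitivity (Ci * w * (A + 2 * x * D) + (Ci * Ci) * w * (t * w) * A)%C.
  - replace (Ci * Ci)%C with (- (1))%C by (apply injective_projections; simpl; ring).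
    unfold x. field.
  - unfold x. ring.
Qed.

(* [t |-> exp (-i w t) * euler w t] has derivative zero; it is written in real and
   imaginary parts because there is no complex exponential at hand. *)
Lemma euler_formula (a b : R) :
  euler (a, b) 1 = (exp (- b) * cos a, exp (- b) * sin a).
Proof.
  set (u := fun t => Re (euler (a, b) (RtoC t))).
  set (v := fun t => Im (euler (a, b) (RtoC t))).
  assert (Du : forall t, is_derive u t (- b * u t - a * v t)).
  { intros t. assert (H := cderiv_Re _ t _ (cderiv_euler (a, b) (RtoC t))).
    replace (- b * u t - a * v t) with (Re (Ci * (a, b) * euler (a, b) t)%C); [exact H|].
    unfold u, v. simpl. unfold Re, Im. ring. }
  assert (Dv : forall t, is_derive v t (a * u t - b * v t)).
  { intros t. assert (H := cderiv_Im _ t _ (cderiv_euler (a, b) (RtoC t))).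
    replace (a * u t - b * v t) with (Im (Ci * (a, b) * euler (a, b) t)%C); [exact H|].
    unfold u, v. simpl. unfold Re, Im. ring. }
  assert (Eu : forall t, Derive (fun x => u x) t = - b * u t - a * v t)
    by (intros t; apply is_derive_unique, Du).
  assert (Ev : forall t, Derive (fun x => v x) t = a * u t - b * v t)
    by (intros t; apply is_derive_unique, Dv).
  assert (E0 : euler (a, b) 0 = 1%C).
  { unfold euler. replace (0 * (a, b) * (0 * (a, b)))%C with (RtoC 0) by ring.
    rewrite cosq_0, s_0. ring. }
  assert (P1 : exp (b * 0) * (u 0 * cos (a * 0) + v 0 * sin (a * 0))
             = exp (b * 1) * (u 1 * cos (a * 1) + v 1 * sin (a * 1))).
  { apply (eq_is_derive (fun t => exp (b * t) * (u t * cos (a * t) + v t * sin (a * t)))); [|lra].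
    intros t _. change zero with 0. auto_derive.
    - split; [eexists; apply Du|split; [eexists; apply Dv|exact I]].
    - rewrite Eu, Ev. ring. }
  assert (P2 : exp (b * 0) * (v 0 * cos (a * 0) - u 0 * sin (a * 0))
             = exp (b * 1) * (v 1 * cos (a * 1) - u 1 * sin (a * 1))).
  { apply (eq_is_derive (fun t => exp (b * t) * (v t * cos (a * t) - u t * sin (a * t)))); [|lra].
    intros t _. change zero with 0. auto_derive.
    - split; [eexists; apply Dv|split; [eexists; apply Du|exact I]].
    - rewrite Eu, Ev. ring. }
  assert (U0 : u 0 = 1) by (unfold u; rewrite E0; reflexivity).
  assert (V0 : v 0 = 0) by (unfold v; rewrite E0; reflexivity).
  rewrite U0, V0, !Rmult_0_r, !Rmult_1_r, exp_0, cos_0, sin_0 in P1, P2.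
  assert (T := sin2_cos2 a). unfold Rsqr in T.
  assert (X : exp b * exp (- b) = 1) by (rewrite <- exp_plus, Rplus_opp_r; apply exp_0).
  assert (P := exp_pos b).
  assert (Z : u 1 * cos a + v 1 * sin a = exp (- b)) by (apply Rmult_eq_reg_l with (exp b); lra).
  assert (Y : v 1 * cos a - u 1 * sin a = 0) by (apply Rmult_eq_reg_l with (exp b); lra).
  apply injective_projections; simpl.
  - change (u 1 = exp (- b) * cos a). rewrite <- Z.
    transitivity (u 1 * (sin a * sin a + cos a * cos a) + sin a * (v 1 * cos a - u 1 * sin a));
      [rewrite T, Y; ring|ring].
  - change (v 1 = exp (- b) * sin a). rewrite <- Z.
    transitivity (v 1 * (sin a * sin a + cos a * cos a) - cos a * (v 1 * cos a - u 1 * sin a));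
      [rewrite T, Y; ring|ring].
Qed.

Lemma euler_1 (w : C) : euler w 1 = (cosq (w * w) + Ci * w * s (w * w))%C.
Proof. unfold euler. now rewrite Cmult_1_l. Qed.

Lemma cosq_plus (a b : R) (w := (a, b) : C) :
  (cosq (w * w) + Ci * w * s (w * w))%C = (exp (- b) * cos a, exp (- b) * sin a).
Proof. rewrite <- euler_1. apply euler_formula. Qed.

(** The previous formula at -w: the square is unchanged and the factor i w changes sign. *)
Lemma cosq_minus (a b : R) (w := (a, b) : C) :
  (cosq (w * w) - Ci * w * s (w * w))%C = (exp b * cos a, - (exp b * sin a)).
Proof.
  assert (H := cosq_plus (- a) (- b)). cbv zeta in H.
  replace (((- a)%R, (- b)%R) * ((- a)%R, (- b)%R))%C with (w * w)%C in H
    by (unfold w; apply injective_projections; simpl; ring).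
  replace (Ci * ((- a)%R, (- b)%R))%C with (- (Ci * w))%C in H
    by (unfold w; apply injective_projections; simpl; ring).
  rewrite Ropp_involutive, cos_neg, sin_neg in H.
  rewrite <- Ropp_mult_distr_r in H. rewrite <- H. ring.
Qed.

(** Half-angle formulas: with m = |z|, the parts p and q satisfy p^2 = (m + x)/2, q^2 = (m - x)/2
    and p q = |y|/2, so the sign of y decides the sign of the imaginary part. *)
Lemma complex_sqrt (z : C) : exists w, z = (w * w)%C.
Proof.
  destruct z as [x y].
  set (m := sqrt (x * x + y * y)).
  assert (Hm : m * m = x * x + y * y) by (apply sqrt_sqrt; nra).
  assert (Hm0 : 0 <= m) by apply sqrt_pos.
  assert (H1 : 0 <= (m + x) / 2) by nra.
  assert (H2 : 0 <= (m - x) / 2) by nra.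
  set (p := sqrt ((m + x) / 2)). set (q := sqrt ((m - x) / 2)).
  assert (Hp : p * p = (m + x) / 2) by now apply sqrt_sqrt.
  assert (Hq : q * q = (m - x) / 2) by now apply sqrt_sqrt.
  assert (Hpq : p * q = Rabs y / 2).
  { unfold p, q. rewrite <- sqrt_mult by assumption.
    replace ((m + x) / 2 * ((m - x) / 2)) with (Rsqr (y / 2)) by (unfold Rsqr; nra).
    rewrite sqrt_Rsqr_abs. unfold Rdiv. rewrite Rabs_mult, (Rabs_pos_eq (/ 2)); lra. }
  destruct (Rle_dec 0 y) as [Hy|Hy].
  - rewrite Rabs_pos_eq in Hpq by lra.
    exists (p, q). apply injective_projections; simpl; lra.
  - rewrite Rabs_left in Hpq by lra.
    exists (p, - q). apply injective_projections; simpl; lra.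
Qed.

(** Combining the two equations with weights cos a and sin a leaves exp(-b) = exp(b). This is the
    step that forces a zero to have a real square root. *)
Lemma exp_balance (a b : R) :
  exp (- b) * cos a = exp b * cos a -> exp (- b) * sin a = exp b * sin a -> b = 0.
Proof.
  intros H1 H2.
  assert (T := sin2_cos2 a). unfold Rsqr in T.
  assert (E : exp (- b) = exp b).
  { assert (exp (- b) * (sin a * sin a + cos a * cos a) = exp b * (sin a * sin a + cos a * cos a));
      [|rewrite T in *; lra].
    transitivity ((exp (- b) * sin a) * sin a + (exp (- b) * cos a) * cos a); [ring|].
    rewrite H1, H2. ring. }
  apply exp_inv in E. lra.
Qed.

(** If s vanishes at w^2, then exp(i w) = c = exp(-i w). The imaginary parts give (exp b + exp(-b))
    sin a = 0, and b = 0 follows. The root is nonzero since s(0) = 1, and its sign is normalised by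
    [Rabs]. *)
Lemma s_zero_real (z : C) :
  s z = 0 -> exists a, 0 < a /\ z = RtoC (a * a).
Proof.
  intros H. destruct (complex_sqrt z) as [[a b] Hw].
  assert (P := cosq_plus a b). assert (M := cosq_minus a b). cbv zeta in P, M.
  rewrite <- Hw, H in P, M.
  assert (E : @eq C (exp (- b) * cos a, exp (- b) * sin a) (exp b * cos a, - (exp b * sin a)))
    by (rewrite <- P, <- M; ring).
  injection E as E1 E2.
  assert (Z : b = 0 /\ sin a = 0).
  { assert (S0 : sin a = 0).
    { assert (X := exp_pos b). assert (Y := exp_pos (- b)).
      assert (Z : (exp b + exp (- b)) * sin a = 0) by lra.
      apply Rmult_integral in Z. lra. }
    split; [|exact S0]. apply exp_balance with a; [exact E1|rewrite S0; ring]. }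
  destruct Z as [Hb _]. subst b.
  exists (Rabs a). split.
  - apply Rabs_pos_lt. intros ->. 
    replace z with (RtoC 0) in H by (rewrite Hw; apply injective_projections; simpl; ring).
    rewrite s_0 in H. apply RtoC_inj in H. lra.
  - rewrite Hw, <- Rabs_mult, Rabs_pos_eq by nra. apply injective_projections; simpl; ring.
Qed.

(** Here exp(i w) = - exp(-i w), so cos a takes the role that sin a has for s. *)
Lemma cosq_zero_real (z : C) :
  cosq z = 0 -> exists a, 0 < a /\ z = RtoC (a * a).
Proof.
  intros H. destruct (complex_sqrt z) as [[a b] Hw].
  assert (P := cosq_plus a b). assert (M := cosq_minus a b). cbv zeta in P, M.
  rewrite <- Hw, H in P, M.
  assert (E : @eq C (exp (- b) * cos a, exp (- b) * sin a) (Copp (exp b * cos a, - (exp b * sin a))))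
    by (rewrite <- P, <- M; ring).
  injection E as E1 E2.
  assert (C0 : cos a = 0).
  { assert (X := exp_pos b). assert (Y := exp_pos (- b)).
    assert (Z : (exp b + exp (- b)) * cos a = 0) by lra.
    apply Rmult_integral in Z. lra. }
  assert (Hb : b = 0) by (apply exp_balance with a; [rewrite C0; ring|lra]). subst b.
  exists (Rabs a). split.
  - apply Rabs_pos_lt. intros ->. rewrite cos_0 in C0. lra.
  - rewrite Hw, <- Rabs_mult, Rabs_pos_eq by nra. apply injective_projections; simpl; ring.
Qed.

(** * Critical points *)

Definition sR (x : R) : R := PSeries s_coef x.
Definition cR (x : R) : R := PSeries c_coef x.
Definition dsR (x : R) : R := Re (ds (RtoC x)).

Lemma cpow_RtoC (x : R) (k : nat) : cpow (RtoC x) k = RtoC (x ^ k).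
Proof.
  induction k as [|k IH]; [reflexivity|]. simpl cpow. rewrite IH, <- RtoC_mult. reflexivity.
Qed.

Lemma CSer_RtoC (a : nat -> R) (x : R) : CSer a (cpow (RtoC x)) = RtoC (PSeries a x).
Proof.
  transitivity (PSeries a x, 0); [|reflexivity]. unfold CSer, PSeries. f_equal.
  - apply Series_ext. intros k. rewrite cpow_RtoC. reflexivity.
  - rewrite (Series_ext _ (fun k => 0 * a k)).
    + rewrite Series_scal_l. ring.
    + intros k. rewrite cpow_RtoC. simpl. ring.
Qed.

Lemma s_RtoC (x : R) : s (RtoC x) = RtoC (sR x).
Proof. exact (CSer_RtoC s_coef x). Qed.

Lemma cosq_RtoC (x : R) : cosq (RtoC x) = RtoC (cR x).
Proof. exact (CSer_RtoC c_coef x). Qed.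

Lemma is_derive_sR (x : R) : is_derive sR x (dsR x).
Proof.
  apply is_derive_ext with (fun u => Re (s (RtoC u))).
  - intros t. now rewrite s_RtoC.
  - apply cderiv_Re, cderiv_s.
Qed.

Lemma is_derive_cR (x : R) : is_derive cR x (- (1 / 2) * sR x).
Proof.
  apply is_derive_ext with (fun u => Re (cosq (RtoC u))).
  - intros t. now rewrite cosq_RtoC.
  - replace (- (1 / 2) * sR x) with (Re (- (/ 2) * s (RtoC x))%C).
    + apply cderiv_Re, cderiv_cosq.
    + rewrite s_RtoC. simpl. field.
Qed.

Lemma cR_sR_dsR (x : R) : cR x = sR x + 2 * x * dsR x.
Proof.
  assert (H := f_equal Re (cosq_s_ds (RtoC x))).
  rewrite cosq_RtoC, s_RtoC in H. unfold dsR. set (d := ds (RtoC x)) in *.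
  destruct d as [d1 d2]. simpl in H. simpl. lra.
Qed.

Lemma sR_0 : sR 0 = 1.
Proof. apply RtoC_inj. rewrite <- s_RtoC. apply s_0. Qed.

Lemma cR_0 : cR 0 = 1.
Proof. apply RtoC_inj. rewrite <- cosq_RtoC. apply cosq_0. Qed.

Lemma cR_sR_sqr (u : R) : cR (u * u) = cos u /\ u * sR (u * u) = sin u.
Proof.
  assert (H := cosq_plus u 0). cbv zeta in H.
  replace ((u, 0) * (u, 0))%C with (RtoC (u * u)) in H
    by (apply injective_projections; simpl; ring).
  rewrite cosq_RtoC, s_RtoC, Ropp_0, exp_0 in H.
  injection H as H1 H2. split; lra.
Qed.

(** With x = - b^2 and w = i b, Euler's formula gives c - b s = exp(-b) and c + b s = exp(b), so s =
    sinh b / b. *)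
Lemma sR_pos_of_nonpos (x : R) : x <= 0 -> 0 < sR x.
Proof.
  intros Hx. destruct (Req_dec x 0) as [->|Hx0]; [rewrite sR_0; lra|].
  set (b := sqrt (- x)).
  assert (Hb : 0 < b) by (apply sqrt_lt_R0; lra).
  assert (Hbb : b * b = - x) by (apply sqrt_sqrt; lra).
  assert (P := cosq_plus 0 b). assert (M := cosq_minus 0 b). cbv zeta in P, M.
  replace ((0, b) * (0, b))%C with (RtoC x) in P, M
    by (apply injective_projections; simpl; lra).
  rewrite cosq_RtoC, s_RtoC, cos_0 in P, M.
  injection P as P1 _. injection M as M1 _.
  assert (exp (- b) < exp b) by (apply exp_increasing; lra).
  assert (0 < b * sR x) by lra. nra.
Qed.

Lemma sR_zero (x : R) : sR x = 0 -> exists u, 0 < u /\ x = u * u /\ sin u = 0.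
Proof.
  intros H. destruct (s_zero_real (RtoC x)) as [u [Hu E]]; [now rewrite s_RtoC, H|].
  apply RtoC_inj in E. exists u. repeat split; trivial.
  destruct (cR_sR_sqr u) as [_ <-]. rewrite <- E, H. ring.
Qed.

Lemma cR_zero (x : R) : cR x = 0 -> exists u, 0 < u /\ x = u * u /\ cos u = 0.
Proof.
  intros H. destruct (cosq_zero_real (RtoC x)) as [u [Hu E]]; [now rewrite cosq_RtoC, H|].
  apply RtoC_inj in E. exists u. repeat split; trivial.
  destruct (cR_sR_sqr u) as [<- _]. now rewrite <- E.
Qed.

Lemma pythagoras (x : R) : 0 < x -> cR x ^ 2 + x * sR x ^ 2 = 1.
Proof.
  intros Hx. destruct (cR_sR_sqr (sqrt x)) as [H1 H2].
  rewrite sqrt_sqrt in H1, H2 by lra.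
  assert (T := sin2_cos2 (sqrt x)). unfold Rsqr in T.
  rewrite <- H1, <- H2 in T. rewrite <- (sqrt_sqrt x) at 2 by lra. nra.
Qed.

(** * The gradient and the classification of its zeros *)

Definition fx (w : W) (x y : C) : C :=
  match w with
  | W_A => (s x * cosq x)%C
  | W_D => (s x * cosq x - y * y)%C
  end.

Definition fy (w : W) (x y : C) : C :=
  match w with W_A => (- (2) * y)%C | W_D => (- (2) * x * y)%C end.

Lemma cderiv_fx (w : W) (x y : C) : cderiv (fun t => fW w t y) x (fx w x y).
Proof.
  assert (Q := cderiv_mult _ _ _ _ _ (cderiv_id x) (cderiv_mult _ _ _ _ _ (cderiv_s x) (cderiv_s x))).
  destruct w.
  - apply cderiv_eq with (1 := cderiv_plus _ _ _ _ _ Q (cderiv_const (- (y * y))%C x)).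
    + intros t. reflexivity.
    + unfold fx. rewrite cosq_s_ds. ring.
  - apply cderiv_eq with (1 := cderiv_plus _ _ _ _ _ Q
      (cderiv_mult _ _ _ _ _ (cderiv_id x) (cderiv_const (- (y * y))%C x))).
    + intros t. unfold fW. ring.
    + unfold fx. rewrite cosq_s_ds. ring.
Qed.

Lemma cderiv_fy (w : W) (x y : C) : cderiv (fun t => fW w x t) y (fy w x y).
Proof.
  assert (Q := fun k => cderiv_mult _ _ _ _ _ (cderiv_const k y)
     (cderiv_mult _ _ _ _ _ (cderiv_id y) (cderiv_id y))).
  assert (K := cderiv_const (x * (s x * s x))%C y).
  destruct w.
  - apply cderiv_eq with (1 := cderiv_plus _ _ _ _ _ K (Q (- (1))%C)).
    + intros t. unfold fW. ring.
    + unfold fy. ring.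
  - apply cderiv_eq with (1 := cderiv_plus _ _ _ _ _ K (Q (- x)%C)).
    + intros t. unfold fW. ring.
    + unfold fy. ring.
Qed.

Lemma critical_iff (w : W) (x y : C) :
  critical w x y <-> fx w x y = 0 /\ fy w x y = 0.
Proof.
  assert (Hx := cderiv_is_derive _ _ _ (cderiv_fx w x y)).
  assert (Hy := cderiv_is_derive _ _ _ (cderiv_fy w x y)).
  split.
  - intros [Kx Ky]. split.
    + rewrite <- (is_C_derive_unique _ _ _ Hx). now apply is_C_derive_unique.
    + rewrite <- (is_C_derive_unique _ _ _ Hy). now apply is_C_derive_unique.
  - intros [Ex Ey]. rewrite Ex in Hx. rewrite Ey in Hy. now split.
Qed.

Lemma Cmult_zero (x y : C) : (x * y)%C = 0 -> x = 0 \/ y = 0.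
Proof.
  intros H. destruct (classic (x = 0)) as [Hx|Hx]; [now left|].
  destruct (classic (y = 0)) as [Hy|Hy]; [now right|].
  exfalso. now apply (Cmult_neq_0 x y).
Qed.

Lemma fW_RtoC (w : W) (a b : R) : fW w (RtoC a) (RtoC b) = RtoC (fR w a b).
Proof.
  unfold fR.
  destruct w; unfold fW; rewrite s_RtoC; apply injective_projections; simpl; ring.
Qed.

Definition hW (w : W) (x : R) : R :=
  match w with W_A => x * sR x ^ 2 | W_D => sR x ^ 2 end.

Definition qW (w : W) (x : R) : R := match w with W_A => 1 | W_D => x end.

Lemma fR_factor (w : W) (a b : R) : fR w a b = qW w a * (hW w a - b ^ 2).
Proof.
  unfold fR. destruct w; unfold fW, qW, hW; rewrite s_RtoC; simpl; ring.
Qed.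

(** The first and third kinds carry the value 0, the second the value 1. *)
Inductive crit_type (w : W) (a b : R) : Prop :=
| crit_saddle : b = 0 -> 0 < a -> sR a = 0 -> crit_type w a b
| crit_max : b = 0 -> 0 < a -> cR a = 0 -> crit_type w a b
| crit_axis : w = W_D -> a = 0 -> b ^ 2 = 1 -> crit_type w a b.

Lemma critical_type (w : W) (x y : C) :
  critical w x y <-> exists a b, x = RtoC a /\ y = RtoC b /\ crit_type w a b.
Proof.
  assert (T2 : RtoC 2 <> 0) by (intros H; apply RtoC_inj in H; lra).
  rewrite critical_iff. split.
  - intros [Hx Hy].
    (* In type A, f_y = -2 y forces y = 0. In type D, f_y = -2 x y leaves also x = 0, where f_x = 1
       - y^2. *)
    assert (K : y = 0 /\ (s x * cosq x)%C = 0 \/ w = W_D /\ x = 0 /\ (y * y)%C = 1).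
    { destruct w; unfold fx, fy in Hx, Hy.
      - left. split; [|exact Hx]. apply Cmult_zero in Hy. destruct Hy as [Hy|Hy]; [|exact Hy].
        exfalso. apply T2. replace (RtoC 2) with (- (- (2)))%C by ring. rewrite Hy. ring.
      - assert (Hxy : (x * y)%C = 0).
        { replace (- (2) * x * y)%C with (- (2) * (x * y))%C in Hy by ring.
          apply Cmult_zero in Hy. destruct Hy as [Hy|Hy]; [|exact Hy].
          exfalso. apply T2. replace (RtoC 2) with (- (- (2)))%C by ring. rewrite Hy. ring. }
        apply Cmult_zero in Hxy. destruct Hxy as [-> | ->].
        + right. rewrite s_0, cosq_0 in Hx. repeat split.
          replace (y * y)%C with (1 - (1 * 1 - y * y))%C by ring. rewrite Hx. ring.
        + left. split; [reflexivity|]. rewrite <- Hx. ring. }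
    destruct K as [[-> K]|[-> [-> K]]].
    + apply Cmult_zero in K. destruct K as [K|K].
      * destruct (s_zero_real x K) as [u [Hu ->]]. exists (u * u), 0.
        repeat split. apply crit_saddle; [reflexivity|nra|].
        rewrite s_RtoC in K. now apply RtoC_inj in K.
      * destruct (cosq_zero_real x K) as [u [Hu ->]]. exists (u * u), 0.
        repeat split. apply crit_max; [reflexivity|nra|].
        rewrite cosq_RtoC in K. now apply RtoC_inj in K.
    + destruct (Cmult_zero (y - 1) (y + 1)) as [E|E].
      * replace ((y - 1) * (y + 1))%C with (y * y - 1)%C by ring. rewrite K. ring.
      * exists 0, 1. split; [reflexivity|]. split; [|apply crit_axis; trivial; ring].
        replace y with ((y - 1) + 1)%C by ring. rewrite E. ring.
      * exists 0, (-1). split; [reflexivity|]. split; [|apply crit_axis; trivial; ring].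
        replace y with ((y + 1) - 1)%C by ring. rewrite E.
        apply injective_projections; simpl; ring.
  - intros [a [b [-> [-> H]]]]. unfold fx, fy. rewrite s_RtoC, cosq_RtoC.
    destruct H as [-> _ H| -> _ H| -> -> H].
    + rewrite H. destruct w; split; ring.
    + rewrite H. destruct w; split; ring.
    + rewrite sR_0, cR_0. split; [|ring].
      rewrite <- !RtoC_mult, <- RtoC_minus. f_equal. lra.
Qed.

(** On the axis y = 0 both functions reduce to x s^2, which is 0 where s vanishes and, by c^2 + x
    s^2 = 1, equal to 1 where c vanishes. *)
Lemma fR_crit (w : W) (a b : R) : crit_type w a b ->
  (fR w a b = 0 <-> (b = 0 /\ 0 < a /\ sR a = 0) \/ (w = W_D /\ a = 0 /\ b ^ 2 = 1)) /\
  (fR w a b = 1 <-> b = 0 /\ 0 < a /\ cR a = 0).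
Proof.
  intros H. rewrite fR_factor.
  assert (E : 0 < a -> b = 0 -> qW w a * (hW w a - b ^ 2) = a * sR a ^ 2).
  { intros _ ->. destruct w; unfold qW, hW; ring. }
  destruct H as [Hb Ha H|Hb Ha H| -> Ha H].
  - assert (P := pythagoras a Ha). rewrite E, H by assumption. rewrite H in P.
    split; split; intros K; try lra; auto.
    destruct K as [_ [_ K]]. rewrite K in P. lra.
  - assert (P := pythagoras a Ha). rewrite E by assumption. rewrite H in P.
    replace (a * sR a ^ 2) with 1 by lra.
    split; split; intros K; try lra; auto.
    destruct K as [[_ [_ K]]|[_ [K _]]]; [rewrite K in P|]; lra.
  - simpl qW. rewrite Ha. split; split; intros K; try lra; auto.
Qed.

(** * Hessians and nodes *)

Definition gx (w : W) (a b : R) : R :=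
  match w with W_A => sR a * cR a | W_D => sR a * cR a - b ^ 2 end.

Definition gy (w : W) (a b : R) : R :=
  match w with W_A => -2 * b | W_D => -2 * a * b end.

Lemma fx_RtoC (w : W) (a b : R) : fx w (RtoC a) (RtoC b) = RtoC (gx w a b).
Proof.
  destruct w; unfold fx, gx; rewrite s_RtoC, cosq_RtoC;
    apply injective_projections; simpl; ring.
Qed.

Lemma fy_RtoC (w : W) (a b : R) : fy w (RtoC a) (RtoC b) = RtoC (gy w a b).
Proof.
  destruct w; unfold fy, gy; apply injective_projections; simpl; ring.
Qed.

Lemma is_derive_fR_x (w : W) (a b : R) : is_derive (fun u => fR w u b) a (gx w a b).
Proof.
  replace (gx w a b) with (Re (fx w (RtoC a) (RtoC b))) by now rewrite fx_RtoC.
  exact (cderiv_Re _ _ _ (cderiv_fx w (RtoC a) (RtoC b))).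
Qed.

Lemma is_derive_fR_y (w : W) (a b : R) : is_derive (fun u => fR w a u) b (gy w a b).
Proof.
  replace (gy w a b) with (Re (fy w (RtoC a) (RtoC b))) by now rewrite fy_RtoC.
  exact (cderiv_Re _ _ _ (cderiv_fy w (RtoC a) (RtoC b))).
Qed.

Lemma is_derive_sR_cR (a b : R) :
  is_derive (fun u => sR u * cR u - b) a (dsR a * cR a - sR a ^ 2 / 2).
Proof.
  assert (Hs := is_derive_sR a). assert (Hc := is_derive_cR a).
  assert (Es : Derive (fun x => sR x) a = dsR a) by now apply is_derive_unique.
  assert (Ec : Derive (fun x => cR x) a = - (1 / 2) * sR a) by now apply is_derive_unique.
  auto_derive.
  - repeat split; eexists; eassumption.
  - rewrite Es, Ec. field.
Qed.

Lemma hxx_eq (w : W) (a b : R) : hxx w a b = dsR a * cR a - sR a ^ 2 / 2.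
Proof.
  unfold hxx. rewrite (Derive_ext _ (fun u => gx w u b))
    by (intros t; apply is_derive_unique, is_derive_fR_x).
  destruct w; unfold gx; apply is_derive_unique.
  - apply is_derive_ext with (2 := is_derive_sR_cR a 0). intros t. simpl. ring.
  - apply is_derive_sR_cR.
Qed.

Lemma hyy_eq (w : W) (a b : R) : hyy w a b = -2 * qW w a.
Proof.
  unfold hyy. rewrite (Derive_ext _ (fun u => gy w a u))
    by (intros t; apply is_derive_unique, is_derive_fR_y).
  destruct w; unfold gy, qW; apply is_derive_unique; auto_derive; trivial; ring.
Qed.

Definition mixed (w : W) (b : R) : R := match w with W_A => 0 | W_D => -2 * b end.

Lemma hxy_eq (w : W) (a b : R) : hxy w a b = mixed w b.
Proof.
  unfold hxy. rewrite (Derive_ext _ (fun u => gx w a u))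
    by (intros t; apply is_derive_unique, is_derive_fR_x).
  destruct w; unfold gx, mixed; apply is_derive_unique; auto_derive; trivial; ring.
Qed.

Lemma hyx_eq (w : W) (a b : R) : hyx w a b = mixed w b.
Proof.
  unfold hyx. rewrite (Derive_ext _ (fun u => gy w u b))
    by (intros t; apply is_derive_unique, is_derive_fR_y).
  destruct w; unfold gy, mixed; apply is_derive_unique; auto_derive; trivial; ring.
Qed.

(** At a double zero c = s + 2 a s' would vanish together with s, contradicting c^2 + a s^2 = 1. *)
Lemma dsR_neq_0_of_zero (a : R) : 0 < a -> sR a = 0 -> dsR a <> 0.
Proof.
  intros Ha H Hd. assert (P := pythagoras a Ha). assert (Q := cR_sR_dsR a).
  rewrite H, Hd in Q. rewrite Q, H in P. lra.
Qed.

Lemma qW_pos (w : W) (a : R) : 0 < a -> 0 < qW w a.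
Proof. destruct w; simpl; lra. Qed.

Lemma hxx_saddle (a : R) : 0 < a -> sR a = 0 -> 0 < dsR a * cR a - sR a ^ 2 / 2.
Proof.
  intros Ha H. assert (D := dsR_neq_0_of_zero a Ha H).
  rewrite cR_sR_dsR, H.
  assert (0 < dsR a * dsR a) by nra. nra.
Qed.

Lemma hxx_max (a : R) : 0 < a -> cR a = 0 -> dsR a * cR a - sR a ^ 2 / 2 < 0.
Proof.
  intros Ha H. assert (P := pythagoras a Ha). rewrite H in *. nra.
Qed.

(** On y = 0 the Hessian is diagonal with f_yy = -2 q < 0, so the sign of f_xx decides. At the two
    axis points of type D, f_yy = 0 and f_xy = -2 b, so the determinant is -4 b^2 = -4. *)
Lemma hessian_critical (w : W) (a b : R) : crit_type w a b ->
  hess_nondegenerate w a b /\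
  (fR w a b = 0 -> hess_indefinite w a b) /\
  (fR w a b = 1 -> hess_negdef w a b).
Proof.
  intros Hc. destruct (fR_crit w a b Hc) as [F0 F1].
  unfold hess_nondegenerate, hess_indefinite, hess_negdef, hess_form.
  rewrite hxx_eq, hyy_eq, hxy_eq, hyx_eq.
  destruct Hc as [Hb Ha H|Hb Ha H|Hw Ha H].
  - assert (K := hxx_saddle a Ha H). assert (Q := qW_pos w a Ha).
    assert (M : mixed w b = 0) by (subst b; destruct w; simpl; ring).
    rewrite M. set (k := dsR a * cR a - sR a ^ 2 / 2) in *. set (q := qW w a) in *.
    split; [assert (0 < k * q) by nra; nra|]. split.
    + intros _. split; [exists 1, 0|exists 0, 1]; lra.
    + intros E. exfalso. apply F1 in E. destruct E as [_ [_ E]].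
      assert (P := pythagoras a Ha). rewrite E, H in P. lra.
  - assert (K := hxx_max a Ha H). assert (Q := qW_pos w a Ha).
    assert (M : mixed w b = 0) by (subst b; destruct w; simpl; ring).
    rewrite M. set (k := dsR a * cR a - sR a ^ 2 / 2) in *. set (q := qW w a) in *.
    split; [assert (0 < - k * q) by nra; nra|]. split.
    + intros E. exfalso. assert (fR w a b = 1) by (apply F1; auto). lra.
    + intros _ v1 v2 Hv.
      assert (V : v1 <> 0 \/ v2 <> 0).
      { destruct (Req_dec v1 0) as [->|]; [|now left].
        right. intros ->. now apply Hv. }
      assert (V1 : 0 <= v1 * v1) by nra. assert (V2 : 0 <= v2 * v2) by nra.
      assert (0 < v1 * v1 \/ 0 < v2 * v2) by (destruct V; [left|right]; nra).
      assert (k * (v1 * v1) <= 0) by nra. assert (0 <= q * (v2 * v2)) by nra.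
      assert (0 < v1 * v1 -> k * (v1 * v1) < 0) by nra.
      assert (0 < v2 * v2 -> 0 < q * (v2 * v2)) by nra.
      replace (k * v1 * v1) with (k * (v1 * v1)) by ring.
      replace (-2 * q * v2 * v2) with (-2 * (q * (v2 * v2))) by ring. lra.
  - subst w a. simpl qW. simpl mixed. set (k := dsR 0 * cR 0 - sR 0 ^ 2 / 2).
    split; [nra|]. split.
    + intros _. split.
      (* With v1 = 1 the form is k - 4 b v2. Since b^2 = 1, this v2 adds 4 (1 + |k|), which
         outweighs k; the opposite v2 serves for the negative value. *)
      * exists 1, (- (b * (1 + Rabs k))). assert (A := Rle_abs (- k)). rewrite Rabs_Ropp in A.
        replace (k * 1 * 1 + -2 * b * 1 * - (b * (1 + Rabs k)) + -2 * b * - (b * (1 + Rabs k)) * 1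
          + -2 * 0 * - (b * (1 + Rabs k)) * - (b * (1 + Rabs k)))
          with (k + 4 * (b ^ 2) * (1 + Rabs k)) by ring.
        rewrite H. assert (B := Rabs_pos k). lra.
      * exists 1, (b * (1 + Rabs k)). assert (A := Rle_abs k).
        replace (k * 1 * 1 + -2 * b * 1 * (b * (1 + Rabs k)) + -2 * b * (b * (1 + Rabs k)) * 1
          + -2 * 0 * (b * (1 + Rabs k)) * (b * (1 + Rabs k)))
          with (k - 4 * (b ^ 2) * (1 + Rabs k)) by ring.
        rewrite H. assert (B := Rabs_pos k). lra.
    + intros E. exfalso. apply F1 in E. lra.
Qed.

(** * Tangents of the curve at a node *)

Lemma Rabs_fst_le_dist2 (p q : R * R) : Rabs (fst q - fst p) <= dist2 q p.
Proof.
  unfold dist2. rewrite <- sqrt_Rsqr_abs. apply sqrt_le_1_alt. unfold Rsqr.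
  assert (X := pow2_ge_0 (snd q - snd p)). lra.
Qed.

Lemma Rabs_snd_le_dist2 (p q : R * R) : Rabs (snd q - snd p) <= dist2 q p.
Proof.
  unfold dist2. rewrite <- sqrt_Rsqr_abs. apply sqrt_le_1_alt. unfold Rsqr.
  assert (X := pow2_ge_0 (fst q - fst p)). lra.
Qed.

Lemma dist2_le_sum (p q : R * R) :
  dist2 q p <= Rabs (fst q - fst p) + Rabs (snd q - snd p).
Proof.
  unfold dist2.
  assert (X := Rabs_pos (fst q - fst p)). assert (Y := Rabs_pos (snd q - snd p)).
  rewrite <- (sqrt_Rsqr (Rabs (fst q - fst p) + Rabs (snd q - snd p))) by lra.
  apply sqrt_le_1_alt. rewrite <- (pow2_abs (fst q - fst p)), <- (pow2_abs (snd q - snd p)).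
  unfold Rsqr. nra.
Qed.

Lemma ex_derive_continuity (g : R -> R) (x eps : R) : ex_derive g x -> 0 < eps ->
  exists d, 0 < d /\ forall t, Rabs (t - x) < d -> Rabs (g t - g x) < eps.
Proof.
  intros H Heps. apply ex_derive_continuous in H.
  destruct (H (fun y => Rabs (y - g x) < eps)) as [d Hd].
  - exists (mkposreal eps Heps). intros y Hy. exact Hy.
  - exists d. split; [apply cond_pos|]. intros t Ht. exact (Hd t Ht).
Qed.

(** In the form q(x) (h(x) - y^2) the function along the curve is a composition of one-variable
    functions, so the chain rule needs no derivative in two variables. *)
Lemma is_derive_fR_curve (w : W) (g1 g2 : R -> R) (t : R) :
  ex_derive g1 t -> ex_derive g2 t ->
  is_derive (fun u => fR w (g1 u) (g2 u)) t
    (gx w (g1 t) (g2 t) * Derive g1 t + gy w (g1 t) (g2 t) * Derive g2 t).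
Proof.
  intros H1 H2.
  apply is_derive_ext with (fun u => qW w (g1 u) * (hW w (g1 u) - g2 u ^ 2));
    [intros u; now rewrite fR_factor|].
  assert (Hs : ex_derive (fun x => sR x) (g1 t)) by (eexists; apply is_derive_sR).
  assert (Es : Derive (fun x => sR x) (g1 t) = dsR (g1 t))
    by apply is_derive_unique, is_derive_sR.
  change (Derive g1 t) with (Derive (fun x => g1 x) t).
  change (Derive g2 t) with (Derive (fun x => g2 x) t).
  destruct w; unfold qW, hW, gx, gy; rewrite cR_sR_dsR; auto_derive.
  - repeat split; assumption.
  - rewrite Es. ring.
  - repeat split; assumption.
  - rewrite Es. ring.
Qed.

(** Near t = 0 the function f is identically zero along the branch, so its derivative there, the
    gradient paired with the tangent, is zero. *)
Lemma branch_tangent (w : W) (eps r : R) (g1 g2 : R -> R) (p : R * R) :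
  0 < eps -> 0 < r -> smooth_branch eps g1 g2 p ->
  (forall t, Rabs t < eps -> dist2 (g1 t, g2 t) p < r -> XR w (g1 t, g2 t)) ->
  gx w (fst p) (snd p) * Derive g1 0 + gy w (fst p) (snd p) * Derive g2 0 = 0.
Proof.
  intros He Hr [Hs [Hp _]] HX. subst p. simpl.
  assert (R0 : Rabs 0 < eps) by now rewrite Rabs_R0.
  destruct (Hs 1%nat 0 R0) as [D1 D2]. simpl in D1, D2.
  assert (K := is_derive_fR_curve w g1 g2 0 D1 D2).
  apply is_derive_unique in K. rewrite <- K.
  destruct (ex_derive_continuity g1 0 (r / 2) D1) as [d1 [Hd1 C1]]; [lra|].
  destruct (ex_derive_continuity g2 0 (r / 2) D2) as [d2 [Hd2 C2]]; [lra|].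
  assert (Hd : 0 < Rmin eps (Rmin d1 d2)) by (repeat apply Rmin_pos; assumption).
  rewrite (Derive_ext_loc _ (fun _ => 0)); [apply Derive_const|].
  exists (mkposreal _ Hd). intros t Ht. change (Rabs (t - 0) < Rmin eps (Rmin d1 d2)) in Ht.
  apply Rmin_Rgt_l in Ht. destruct Ht as [Ht1 Ht]. apply Rmin_Rgt_l in Ht. destruct Ht as [Ht2 Ht3].
  specialize (C1 t Ht2). specialize (C2 t Ht3).
  apply HX.
  - now rewrite Rminus_0_r in Ht1.
  - apply Rle_lt_trans with (1 := dist2_le_sum _ _). simpl. lra.
Qed.

(* Two independent tangent directions at a node force the gradient to vanish. *)
Lemma node_gradient_zero (w : W) (p : R * R) : is_node (XR w) p ->
  XR w p /\ gx w (fst p) (snd p) = 0 /\ gy w (fst p) (snd p) = 0.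
Proof.
  intros [HX [eps [r [g1 [g2 [h1 [h2 [He [Hr [Hg [Hh [Hdet Hloc]]]]]]]]]]]].
  split; [exact HX|].
  assert (Tg := branch_tangent w eps r g1 g2 p He Hr Hg
    (fun t Ht Hd => proj2 (Hloc _ Hd) (ex_intro _ t (conj Ht (or_introl eq_refl))))).
  assert (Th := branch_tangent w eps r h1 h2 p He Hr Hh
    (fun t Ht Hd => proj2 (Hloc _ Hd) (ex_intro _ t (conj Ht (or_intror eq_refl))))).
  set (A := gx w (fst p) (snd p)) in *. set (B := gy w (fst p) (snd p)) in *.
  set (D := Derive g1 0 * Derive h2 0 - Derive g2 0 * Derive h1 0) in *.
  (* Cramer's rule: eliminating one unknown multiplies the other by the nonzero determinant [D]. *)
  split; apply Rmult_eq_reg_r with D; trivial; unfold D.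
  - transitivity ((A * Derive g1 0 + B * Derive g2 0) * Derive h2 0
      - (A * Derive h1 0 + B * Derive h2 0) * Derive g2 0); [ring|rewrite Tg, Th; ring].
  - transitivity ((A * Derive h1 0 + B * Derive h2 0) * Derive g1 0
      - (A * Derive g1 0 + B * Derive g2 0) * Derive h1 0); [ring|rewrite Tg, Th; ring].
Qed.

(** * Explicit branches through the critical points of value 0 *)

Definition quad_trig (u : R) (f : R -> R) : Prop :=
  exists k0 k1 k2 m n, forall t, f t = k0 + k1 * t + k2 * t ^ 2 + m * sin (u + t) + n * cos (u + t).

(** The class is closed under differentiation, so smoothness is an induction on the order. It
    contains all branch coordinates used below except those involving s. *)
Lemma quad_trig_ex_derive_n (u : R) (f : R -> R) (n : nat) (t : R) :
  quad_trig u f -> ex_derive_n f n t.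
Proof.
  intros Hf.
  assert (Q : forall g, quad_trig u g -> quad_trig u (Derive g) /\ forall t, ex_derive g t).
  { intros g [k0 [k1 [k2 [m [n' Hg]]]]].
    assert (D : forall t, is_derive g t
      (k1 + 2 * k2 * t + 0 * t ^ 2 + - n' * sin (u + t) + m * cos (u + t))).
    { intros x. apply is_derive_ext with (1 := fun t => eq_sym (Hg t)).
      auto_derive; trivial. ring. }
    split.
    - exists k1, (2 * k2), 0, (- n'), m. intros x. now apply is_derive_unique.
    - intros x. eexists. apply D. }
  destruct n as [|n]; [exact I|]. simpl. apply Q.
  induction n as [|n IH]; [exact Hf|]. simpl. now apply Q.
Qed.

Lemma fast_CV_radius (a : nat -> R) (x : R) : fast a -> Rbar_lt (Rabs x) (CV_radius a).
Proof.
  intros Ha. unfold CV_radius.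
  destruct (Lub_Rbar_correct (CV_disk a)) as [H _].
  assert (A := Rabs_pos x).
  apply Rbar_lt_le_trans with (Finite (Rabs x + 1)); [simpl; lra|].
  apply H. unfold CV_disk.
  apply ex_series_ext with (2 := Ha (Rabs x + 1) ltac:(lra)).
  intros k. rewrite Rabs_mult, (Rabs_pos_eq (_ ^ _)); [reflexivity|apply pow_le; lra].
Qed.

Lemma sR_smooth (a : R) (n : nat) (t : R) : ex_derive_n (fun t => sR (t + a)) n t.
Proof.
  apply ex_derive_n_comp_trans. apply ex_derive_n_PSeries, fast_CV_radius, fast_s.
Qed.

Lemma is_derive_sR_shift (a t : R) : is_derive (fun t => sR (t + a)) t (dsR (t + a)).
Proof.
  assert (Hs : ex_derive (fun x => sR x) (t + a)) by (eexists; apply is_derive_sR).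
  assert (Es : Derive (fun x => sR x) (t + a) = dsR (t + a))
    by apply is_derive_unique, is_derive_sR.
  auto_derive; [auto|]. rewrite Es. ring.
Qed.

Lemma XR_iff (w : W) (a b : R) : XR w (a, b) <-> qW w a = 0 \/ b ^ 2 = hW w a.
Proof.
  unfold XR. simpl fst. simpl snd. rewrite fR_factor. split.
  - intros H. apply Rmult_integral in H. destruct H; [now left|right; lra].
  - intros [-> | ->]; ring.
Qed.

Lemma sqr_eq_cases (x y : R) : x ^ 2 = y ^ 2 -> x = y \/ x = - y.
Proof.
  intros H. assert (E : (x - y) * (x + y) = 0) by lra.
  apply Rmult_integral in E. destruct E; [left|right]; lra.
Qed.

Lemma Derive_sqr_shift (u t : R) : Derive (fun t => (u + t) ^ 2) t = 2 * (u + t).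
Proof. apply is_derive_unique. auto_derive; trivial. ring. Qed.

Lemma Derive_sin_shift (u c t : R) : Derive (fun t => c * sin (u + t)) t = c * cos (u + t).
Proof. apply is_derive_unique. auto_derive; trivial. ring. Qed.

Lemma Derive_shift (a t : R) : Derive (fun t => t + a) t = 1.
Proof. apply is_derive_unique. auto_derive; trivial. Qed.

(** For |t| < u the quantity u + t is positive, so its square has nonzero derivative and is
    injective in t. *)
Lemma parabola_branch (u c : R) : 0 < u ->
  smooth_branch u (fun t => (u + t) ^ 2) (fun t => c * sin (u + t)) (u * u, c * sin u).
Proof.
  intros Hu. repeat split.
  - apply quad_trig_ex_derive_n with u. exists (u ^ 2), (2 * u), 1, 0, 0. intros; ring.
  - apply quad_trig_ex_derive_n with u. exists 0, 0, 0, c, 0. intros; ring.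
  - f_equal; [ring|now rewrite Rplus_0_r].
  - intros t Ht. apply Rabs_def2 in Ht.
    rewrite Derive_sqr_shift. intros E. injection E as E _. lra.
  - intros t t' Ht Ht' E. apply Rabs_def2 in Ht, Ht'. injection E as E _.
    destruct (sqr_eq_cases (u + t) (u + t')); [ring_simplify in E|..]; lra.
Qed.

(** In the coordinate v = sqrt x the curve is y^2 = sin^2 v. The radius u^2 keeps x between 0 and 2
    u^2, hence |v - u| < u. *)
Lemma saddle_node_A (u : R) : 0 < u -> sin u = 0 -> is_node (XR W_A) (u * u, 0).
Proof.
  intros Hu Hsin.
  assert (XE : forall v b, 0 < v -> (XR W_A (v ^ 2, b) <-> b ^ 2 = sin v ^ 2)).
  { intros v b Hv. rewrite XR_iff. simpl qW. simpl hW.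
    destruct (cR_sR_sqr v) as [_ <-].
    replace (v * (v * 1)) with (v * v) by ring.
    split; [intros [H|H]; [lra|rewrite H; ring]|intros H; right; rewrite H; ring]. }
  split.
  - replace (u * u) with (u ^ 2) by ring. apply XE; [exact Hu|rewrite Hsin; ring].
  - exists u, (u * u), (fun t => (u + t) ^ 2), (fun t => 1 * sin (u + t)),
      (fun t => (u + t) ^ 2), (fun t => -1 * sin (u + t)).
    split; [exact Hu|]. split; [nra|].
    assert (B1 := parabola_branch u 1 Hu). assert (B2 := parabola_branch u (-1) Hu).
    rewrite Hsin, Rmult_0_r in B1, B2.
    split; [exact B1|]. split; [exact B2|].
    split.
    + rewrite Derive_sqr_shift, !Derive_sin_shift, Rplus_0_r.
      assert (T := sin2_cos2 u). unfold Rsqr in T. rewrite Hsin in T.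
      (* The determinant of the two tangents is -4 u cos u. *)
      assert (cos u <> 0) by nra. intros E.
      assert (E' : u * cos u = 0) by lra. apply Rmult_integral in E'. lra.
    + intros [a b] Hd. assert (Ha := Rle_lt_trans _ _ _ (Rabs_fst_le_dist2 _ _) Hd).
      simpl in Ha. apply Rabs_def2 in Ha. split.
      * intros HX. set (v := sqrt a).
        assert (Hv : 0 < v) by (apply sqrt_lt_R0; lra).
        assert (Hva : v ^ 2 = a) by (simpl; rewrite Rmult_1_r; apply sqrt_sqrt; lra).
        rewrite <- Hva in HX. apply XE in HX; [|exact Hv].
        exists (v - u). split; [apply Rabs_def1; nra|].
        replace (u + (v - u)) with v by ring. rewrite Hva.
        apply sqr_eq_cases in HX. destruct HX as [-> | ->]; [left|right]; f_equal; ring.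
      * intros [t [Ht E]]. apply Rabs_def2 in Ht.
        destruct E as [E|E]; injection E as -> ->; apply XE; try lra; ring.
Qed.

Lemma graph_branch (a c : R) (eps : R) :
  smooth_branch eps (fun t => t + a) (fun t => c * sR (t + a)) (a, c * sR a).
Proof.
  repeat split.
  - apply quad_trig_ex_derive_n with 0. exists a, 1, 0, 0, 0. intros; ring.
  - apply ex_derive_n_scal_l, sR_smooth.
  - now rewrite Rplus_0_l.
  - intros t _. rewrite Derive_shift.
    intros E. injection E as E _. lra.
  - intros t t' _ _ E. injection E as E _. lra.
Qed.

Lemma Derive_graph (a c : R) : Derive (fun t => c * sR (t + a)) 0 = c * dsR a.
Proof.
  rewrite Derive_scal. f_equal. apply is_derive_unique.
  assert (H := is_derive_sR_shift a 0). now rewrite Rplus_0_l in H.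
Qed.

(** The branches have slopes s'(a) and - s'(a), with s'(a) nonzero. The radius a keeps the ball away
    from the line x = 0, which also belongs to the curve. *)
Lemma saddle_node_D (a : R) : 0 < a -> sR a = 0 -> is_node (XR W_D) (a, 0).
Proof.
  intros Ha H.
  split; [apply XR_iff; right; simpl; rewrite H; ring|].
  exists a, a, (fun t => t + a), (fun t => 1 * sR (t + a)),
    (fun t => t + a), (fun t => -1 * sR (t + a)).
  assert (B1 := graph_branch a 1 a). assert (B2 := graph_branch a (-1) a).
  rewrite H, Rmult_0_r in B1, B2.
  do 2 (split; [exact Ha|]).
  split; [exact B1|]. split; [exact B2|].
  split.
  - rewrite !Derive_graph, !Derive_shift.
    assert (D := dsR_neq_0_of_zero a Ha H). lra.
  - intros [x y] Hd. assert (Hx := Rle_lt_trans _ _ _ (Rabs_fst_le_dist2 _ _) Hd).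
    simpl in Hx. rewrite XR_iff. simpl qW. simpl hW. split.
    + intros HX. exists (x - a). split; [exact Hx|].
      replace (x - a + a) with x by ring. apply Rabs_def2 in Hx.
      destruct HX as [HX|HX]; [lra|].
      destruct (sqr_eq_cases y (sR x)) as [-> | ->]; [simpl; exact HX|left|right]; f_equal; ring.
    + intros [t [_ E]]. right. destruct E as [E|E]; injection E as -> ->; ring.
Qed.

Lemma sR_pos_lt_1 (x : R) : x < 1 -> 0 < sR x.
Proof.
  intros H. destruct (Rle_dec x 0) as [Hx|Hx]; [now apply sR_pos_of_nonpos|].
  set (u := sqrt x). assert (Hu : 0 < u) by (apply sqrt_lt_R0; lra).
  assert (Hux : u * u = x) by (apply sqrt_sqrt; lra).
  assert (P := PI2_1).
  assert (Hs : 0 < sin u) by (apply sin_gt_0; nra).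
  destruct (cR_sR_sqr u) as [_ E]. rewrite Hux in E. nra.
Qed.

(** The line x = 0 crosses the graph of b s. Within distance 1, s(x) is positive by [sR_pos_lt_1]
    and y has the sign of b, which excludes the graph of - b s. *)
Lemma axis_node_D (b : R) : b ^ 2 = 1 -> is_node (XR W_D) (0, b).
Proof.
  intros Hb. split; [apply XR_iff; left; reflexivity|].
  exists 1, 1, (fun t => t + 0), (fun t => b * sR (t + 0)), (fun _ => 0), (fun t => b + t).
  do 2 (split; [lra|]).
  assert (D0 : forall t, Derive (fun t => b + t) t = 1)
    by (intros t; apply is_derive_unique; auto_derive; trivial).
  split; [replace (0, b) with (0, b * sR 0) by (rewrite sR_0; f_equal; ring); apply graph_branch|].
  split.
  { repeat split.
    - apply quad_trig_ex_derive_n with 0. exists 0, 0, 0, 0, 0. intros; ring.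
    - apply quad_trig_ex_derive_n with 0. exists b, 1, 0, 0, 0. intros; ring.
    - f_equal. ring.
    - intros t _. rewrite D0. intros E. injection E as _ E. lra.
    - intros t t' _ _ E. injection E as E. lra. }
  split.
  - rewrite D0, Derive_const, Derive_shift. lra.
  - intros [x y] Hd. assert (Hx := Rle_lt_trans _ _ _ (Rabs_fst_le_dist2 _ _) Hd).
    assert (Hy := Rle_lt_trans _ _ _ (Rabs_snd_le_dist2 _ _) Hd).
    simpl in Hx, Hy. rewrite XR_iff. simpl qW. simpl hW. split.
    + intros [-> | HX].
      * exists (y - b). split; [exact Hy|]. right. f_equal. ring.
      * exists x. rewrite Rminus_0_r in Hx. split; [exact Hx|]. left.
        rewrite Rplus_0_r. f_equal.
        apply Rabs_def2 in Hx, Hy. assert (P := sR_pos_lt_1 x ltac:(lra)).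
        assert (Cb : b = 1 \/ b = - (1)) by (apply sqr_eq_cases; rewrite Hb; ring).
        destruct (sqr_eq_cases y (sR x)) as [E|E]; [simpl; exact HX|..];
          destruct Cb as [-> | ->]; lra.
    + intros [t [_ E]]. destruct E as [E|E]; injection E as -> ->; [right|now left].
      simpl in Hb. replace ((b * sR (t + 0)) ^ 2) with ((b * (b * 1)) * sR (t + 0) ^ 2) by ring.
      rewrite Hb. ring.
Qed.

Lemma node_iff (w : W) (p : R * R) : is_node (XR w) p <->
  exists x y : C, critical w x y /\ fW w x y = RtoC 0 /\ x = RtoC (fst p) /\ y = RtoC (snd p).
Proof.
  split.
  - intros H. destruct (node_gradient_zero w p H) as [HX [Hx Hy]].
    exists (RtoC (fst p)), (RtoC (snd p)). split; [|split; [|split; reflexivity]].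
    + apply critical_iff. now rewrite fx_RtoC, fy_RtoC, Hx, Hy.
    + rewrite fW_RtoC. f_equal. exact HX.
  - destruct p as [p1 p2]. simpl. intros [x [y [Hc [Hf [-> ->]]]]].
    apply critical_type in Hc. destruct Hc as [a [b [Ea [Eb Hc]]]].
    apply RtoC_inj in Ea, Eb. subst a b.
    rewrite fW_RtoC in Hf. apply RtoC_inj in Hf.
    apply (fR_crit w p1 p2 Hc) in Hf. destruct Hf as [[-> [Hp Hs]]|[-> [-> Hb]]].
    + destruct w.
      * destruct (sR_zero p1 Hs) as [u [Hu [-> Hsin]]]. now apply saddle_node_A.
      * now apply saddle_node_D.
    + now apply axis_node_D.
Qed.

(** * Components of the complement *)

Lemma connected2_union (A B : R * R -> Prop) (p : R * R) :
  connected2 A -> connected2 B -> A p -> B p -> connected2 (fun q => A q \/ B q).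
Proof.
  intros HA HB Ap Bp [U [V [OU [OV [C [D [[a [Aa Ua]] [b [Ab Vb]]]]]]]]].
  assert (K : forall E : R * R -> Prop, connected2 E -> (forall q, E q -> A q \/ B q) ->
    forall q q', E q -> E q' -> U q -> V q' -> False).
  { intros E HE HEAB q q' Eq Eq' Uq Vq'. apply HE. exists U, V.
    repeat split; eauto. }
  assert (KA := K A HA (fun q H => or_introl H)).
  assert (KB := K B HB (fun q H => or_intror H)).
  destruct (C p (or_introl Ap)) as [Up|Vp].
  - destruct Ab as [Ab|Bb]; eauto.
  - destruct Aa as [Aa|Ba]; eauto.
Qed.

(** Let m be the supremum of the times up to which the path stays in U. If g(m) is in U, openness
    pushes the stay beyond m; if in V, points just before m lie in both sets. Being 1-Lipschitz is
    all the continuity needed, as only horizontal and vertical segments are used. *)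
Lemma path_separation (g : R -> R * R) (U V : R * R -> Prop) (t0 t1 : R) :
  (forall t t', dist2 (g t) (g t') <= Rabs (t - t')) ->
  open2 U -> open2 V -> t0 < t1 ->
  (forall t, t0 <= t <= t1 -> U (g t) \/ V (g t)) ->
  (forall t, t0 <= t <= t1 -> U (g t) -> V (g t) -> False) ->
  U (g t0) -> V (g t1) -> False.
Proof.
  intros Hg OU OV H01 HC HD H0 H1.
  set (E := fun t => t0 <= t <= t1 /\ forall r, t0 <= r <= t -> U (g r)).
  assert (E0 : E t0).
  { split; [lra|]. intros r Hr. replace r with t0 by lra. exact H0. }
  destruct (completeness E) as [m [Hub Hlub]].
  { exists t1. intros t [Ht _]. lra. }
  { now exists t0. }
  assert (M0 : t0 <= m) by now apply Hub.
  assert (M1 : m <= t1) by (apply Hlub; intros t [Ht _]; lra).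
  assert (Hbelow : forall r, t0 <= r < m -> U (g r)).
  { intros r Hr. apply NNPP. intros N.
    assert (m <= r); [|lra]. apply Hlub. intros t [Ht HtU].
    apply Rnot_lt_le. intros Hlt. apply N, HtU. lra. }
  destruct (HC m (conj M0 M1)) as [Um|Vm].
  - destruct (OU _ Um) as [r [Hr Hball]].
    assert (Hm : m < t1).
    { destruct (Rle_lt_or_eq_dec _ _ M1) as [|E1]; [assumption|].
      exfalso. apply (HD t1); [lra|now rewrite <- E1|exact H1]. }
    set (e := Rmin (r / 2) (t1 - m)).
    assert (He : 0 < e) by (apply Rmin_pos; lra).
    assert (He1 : e <= r / 2) by apply Rmin_l.
    assert (He2 : e <= t1 - m) by apply Rmin_r.
    assert (m + e <= m); [|lra]. apply Hub. split; [lra|].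
    intros x Hx. destruct (Rlt_le_dec x m) as [Hxm|Hxm]; [apply Hbelow; lra|].
    apply Hball. apply Rle_lt_trans with (1 := Hg _ _).
    rewrite Rabs_pos_eq; lra.
  - destruct (OV _ Vm) as [r [Hr Hball]].
    destruct (Rle_lt_or_eq_dec _ _ M0) as [Hm|Em].
    + set (x := Rmax t0 (m - r / 2)).
      assert (X0 : t0 <= x) by apply Rmax_l. assert (X1 : m - r / 2 <= x) by apply Rmax_r.
      assert (X2 : x < m) by (apply Rmax_lub_lt; lra).
      apply (HD x); [lra|apply Hbelow; lra|].
      apply Hball. apply Rle_lt_trans with (1 := Hg _ _). apply Rabs_def1; lra.
    + apply (HD t0); [lra|exact H0|now rewrite Em].
Qed.

Lemma path_connected2 (g : R -> R * R) (a b : R) :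
  (forall t t', dist2 (g t) (g t') <= Rabs (t - t')) ->
  connected2 (fun p => exists t, a <= t <= b /\ p = g t).
Proof.
  intros Hg [U [V [OU [OV [C [D [[p [[t0 [T0 ->]] Up]] [q [[t1 [T1 ->]] Vq]]]]]]]]].
  assert (C' : forall t, a <= t <= b -> U (g t) \/ V (g t)) by (intros; apply C; eauto).
  assert (D' : forall t, a <= t <= b -> U (g t) -> V (g t) -> False)
    by (intros t Ht; apply D; eauto).
  destruct (Rtotal_order t0 t1) as [H|[H|H]].
  - apply (path_separation g U V t0 t1); trivial.
    + intros t Ht. apply C'. lra.
    + intros t Ht. apply D'. lra.
  - subst t1. apply (D' t0); trivial.
  - apply (path_separation g V U t1 t0); trivial.
    + intros t Ht. apply or_comm, C'. lra.
    + intros t Ht Vt Ut. apply (D' t); trivial. lra.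
Qed.

Lemma component_sym (S : R * R -> Prop) (p q : R * R) : component S p q -> component S q p.
Proof. intros [A [HA [HS [Ap Aq]]]]. now exists A. Qed.

Lemma component_trans (S : R * R -> Prop) (p q r : R * R) :
  component S p q -> component S q r -> component S p r.
Proof.
  intros [A [HA [AS [Ap Aq]]]] [B [HB [BS [Bq Br]]]].
  exists (fun x => A x \/ B x). split; [now apply connected2_union with q|].
  split; [intros x [Ax|Bx]; auto|auto].
Qed.

Lemma component_path (S : R * R -> Prop) (g : R -> R * R) (t0 t1 : R) :
  (forall t t', dist2 (g t) (g t') <= Rabs (t - t')) ->
  (forall t, Rmin t0 t1 <= t <= Rmax t0 t1 -> S (g t)) ->
  component S (g t0) (g t1).
Proof.
  intros Hg HS.
  exists (fun p => exists t, Rmin t0 t1 <= t <= Rmax t0 t1 /\ p = g t).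
  split; [now apply path_connected2|].
  split; [intros q [t [Ht ->]]; auto|].
  split; eexists; (split; [|reflexivity]);
    (split; [first [apply Rmin_l|apply Rmin_r]|first [apply Rmax_l|apply Rmax_r]]).
Qed.

Lemma component_horizontal (S : R * R -> Prop) (x x' y : R) :
  (forall t, Rmin x x' <= t <= Rmax x x' -> S (t, y)) -> component S (x, y) (x', y).
Proof.
  apply (component_path S (fun t => (t, y))). intros t t'.
  apply Rle_trans with (1 := dist2_le_sum _ _). simpl. rewrite Rminus_diag, Rabs_R0. lra.
Qed.

Lemma component_vertical (S : R * R -> Prop) (x y y' : R) :
  (forall t, Rmin y y' <= t <= Rmax y y' -> S (x, t)) -> component S (x, y) (x, y').
Proof.
  apply (component_path S (fun t => (x, t))). intros t t'.
  apply Rle_trans with (1 := dist2_le_sum _ _). simpl. rewrite Rminus_diag, Rabs_R0. lra.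
Qed.

Lemma component_refl (S : R * R -> Prop) (p : R * R) : S p -> component S p p.
Proof.
  destruct p as [x y]. intros H. apply component_vertical. intros t Ht.
  rewrite Rmin_left, Rmax_left in Ht by lra. now replace t with y by lra.
Qed.

(** A connected set through c and a point outside U would be separated by U and V. *)
Lemma component_clopen (S U V : R * R -> Prop) (c p : R * R) :
  open2 U -> open2 V -> (forall q, S q -> U q \/ V q) ->
  (forall q, U q -> V q -> False) -> U c -> component S c p -> U p.
Proof.
  intros OU OV C D Uc [A [HA [AS [Ac Ap]]]].
  destruct (C p (AS p Ap)) as [Up|Vp]; [exact Up|].
  exfalso. apply HA. exists U, V. repeat split; eauto.
Qed.

Lemma open2_and (U V : R * R -> Prop) : open2 U -> open2 V -> open2 (fun p => U p /\ V p).
Proof.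
  intros OU OV p [Up Vp].
  destruct (OU p Up) as [r [Hr HU]], (OV p Vp) as [r' [Hr' HV]].
  exists (Rmin r r'). split; [now apply Rmin_pos|]. intros q Hq.
  apply Rmin_Rgt_l in Hq. split; [apply HU|apply HV]; apply Hq.
Qed.

Lemma open2_or (U V : R * R -> Prop) : open2 U -> open2 V -> open2 (fun p => U p \/ V p).
Proof.
  intros OU OV p [Up|Vp].
  - destruct (OU p Up) as [r [Hr HU]]. exists r. auto.
  - destruct (OV p Vp) as [r [Hr HV]]. exists r. auto.
Qed.

Lemma open2_pos (F : R * R -> R) :
  (forall p eps, 0 < eps -> exists r, 0 < r /\
     forall q, dist2 q p < r -> Rabs (F q - F p) < eps) ->
  open2 (fun p => 0 < F p).
Proof.
  intros H p Hp. destruct (H p (F p) Hp) as [r [Hr HF]].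
  exists r. split; [exact Hr|]. intros q Hq. specialize (HF q Hq).
  apply Rabs_def2 in HF. lra.
Qed.

Lemma open2_fst_gt (a : R) : open2 (fun p => a < fst p).
Proof.
  intros p Hp. exists (fst p - a). split; [lra|]. intros q Hq.
  assert (X := Rle_lt_trans _ _ _ (Rabs_fst_le_dist2 p q) Hq). apply Rabs_def2 in X. lra.
Qed.

Lemma open2_fst_lt (a : R) : open2 (fun p => fst p < a).
Proof.
  intros p Hp. exists (a - fst p). split; [lra|]. intros q Hq.
  assert (X := Rle_lt_trans _ _ _ (Rabs_fst_le_dist2 p q) Hq). apply Rabs_def2 in X. lra.
Qed.

Lemma ex_derive_hW (w : W) (x : R) : ex_derive (hW w) x.
Proof.
  assert (Hs : ex_derive (fun x => sR x) x) by (eexists; apply is_derive_sR).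
  destruct w; unfold hW; auto_derive; auto.
Qed.

Definition gap (w : W) (p : R * R) : R := hW w (fst p) - snd p ^ 2.

Lemma gap_continuous (w : W) (p : R * R) (eps : R) : 0 < eps -> exists r, 0 < r /\
  forall q, dist2 q p < r -> Rabs (gap w q - gap w p) < eps.
Proof.
  intros He.
  destruct (ex_derive_continuity (hW w) (fst p) (eps / 2) (ex_derive_hW w _)) as [d [Hd C]]; [lra|].
  destruct (ex_derive_continuity (fun y => y ^ 2) (snd p) (eps / 2)) as [d' [Hd' C']];
    [auto_derive; trivial|lra|].
  exists (Rmin d d'). split; [now apply Rmin_pos|]. intros q Hq.
  apply Rmin_Rgt_l in Hq. destruct Hq as [Hq Hq'].
  specialize (C (fst q) (Rle_lt_trans _ _ _ (Rabs_fst_le_dist2 _ _) Hq)).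
  specialize (C' (snd q) (Rle_lt_trans _ _ _ (Rabs_snd_le_dist2 _ _) Hq')).
  unfold gap. apply Rabs_def2 in C, C'. apply Rabs_def1; lra.
Qed.

Lemma complementX_iff (w : W) (p : R * R) : complementX w p <-> qW w (fst p) <> 0 /\ gap w p <> 0.
Proof.
  unfold complementX, XR. rewrite fR_factor. fold (gap w p). split.
  - intros H. split; intros E; apply H; rewrite E; ring.
  - intros [H1 H2] E. apply Rmult_integral in E. tauto.
Qed.

(** * The strips between consecutive zeros of x s^2, starting from x = 0 *)

Definition lo (n : nat) : R := (INR n * PI) ^ 2.

Definition in_strip (n : nat) (x : R) : Prop := lo n < x /\ x < lo (S n).

Definition region (w : W) (n : nat) (p : R * R) : Prop := in_strip n (fst p) /\ 0 < gap w p.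

Lemma lo_nonneg (n : nat) : 0 <= lo n.
Proof. apply pow2_ge_0. Qed.

Lemma in_strip_sqr (n : nat) (u : R) : 0 <= u ->
  (in_strip n (u * u) <-> INR n * PI < u < INR (S n) * PI).
Proof.
  intros Hu. unfold in_strip, lo. assert (P := PI_RGT_0).
  assert (N := pos_INR n). rewrite S_INR.
  assert (A : 0 <= INR n * PI) by nra. assert (B : 0 <= (INR n + 1) * PI) by nra.
  split; intros [H1 H2]; split; nra.
Qed.

Lemma sin_INR_PI (n : nat) : sin (INR n * PI) = 0.
Proof. apply sin_eq_0_1. exists (Z.of_nat n). now rewrite INR_IZR_INZ. Qed.

Lemma between_INR (n : nat) (k : Z) : ~ (INR n < IZR k < INR (S n)).
Proof.
  rewrite !INR_IZR_INZ, Nat2Z.inj_succ. intros [H1 H2].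
  apply lt_IZR in H1, H2. lia.
Qed.

Lemma in_strip_sR (n : nat) (x : R) : in_strip n x -> sR x <> 0.
Proof.
  intros Hx H. destruct (sR_zero x H) as [u [Hu [-> Hs]]].
  apply in_strip_sqr in Hx; [|lra].
  apply sin_eq_0_0 in Hs. destruct Hs as [k ->]. assert (P := PI_RGT_0).
  apply (between_INR n k). nra.
Qed.

Lemma in_strip_pos (n : nat) (x : R) : in_strip n x -> 0 < x.
Proof. intros [H _]. assert (L := lo_nonneg n). lra. Qed.

Lemma hW_pos (w : W) (x : R) : 0 < x -> sR x <> 0 -> 0 < hW w x.
Proof. intros Hx Hs. assert (0 < sR x ^ 2) by nra. destruct w; simpl hW; nra. Qed.

Lemma strip_exists (x : R) : 0 < x -> sR x <> 0 -> exists n, in_strip n x.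
Proof.
  intros Hx Hs. set (u := sqrt x).
  assert (Hu : 0 < u) by (apply sqrt_lt_R0; lra).
  assert (Hux : u * u = x) by (apply sqrt_sqrt; lra).
  assert (P := PI_RGT_0).
  destruct (nfloor_ex (u / PI)) as [n [N1 N2]].
  { apply Rlt_le, Rdiv_lt_0_compat; lra. }
  assert (E : u = u / PI * PI) by (field; lra).
  exists n. rewrite <- Hux. apply in_strip_sqr; [lra|]. rewrite S_INR.
  split; [|rewrite E; apply Rmult_lt_compat_r; lra].
  (* The floor allows u = n PI, but then s(x) = 0, which is excluded. *)
  destruct N1 as [N1|N1]; [rewrite E; apply Rmult_lt_compat_r; lra|].
  exfalso. destruct (cR_sR_sqr u) as [_ K]. rewrite Hux in K.
  assert (Z : sin u = 0) by (rewrite E, <- N1; apply sin_INR_PI). rewrite Z in K.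
  apply Rmult_integral in K. destruct K as [K|K]; [lra|contradiction].
Qed.

Definition center (n : nat) : R := ((INR n + / 2) * PI) * ((INR n + / 2) * PI).

Lemma center_strip (n : nat) : in_strip n (center n).
Proof.
  assert (N := pos_INR n). assert (P := PI_RGT_0).
  apply in_strip_sqr; [nra|]. rewrite S_INR. split; nra.
Qed.

Lemma cR_center (n : nat) : cR (center n) = 0.
Proof.
  unfold center. destruct (cR_sR_sqr ((INR n + / 2) * PI)) as [-> _].
  apply cos_eq_0_1. exists (Z.of_nat n). rewrite INR_IZR_INZ. field.
Qed.

(** A zero of cos has the form k PI + PI/2; the strip leaves n - 1 < k < n + 1, hence k = n. *)
Lemma strip_cR_zero (n : nat) (x : R) : in_strip n x -> cR x = 0 -> x = center n.
Proof.
  intros Hx H. destruct (cR_zero x H) as [u [Hu [-> Hc]]].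
  apply in_strip_sqr in Hx; [|lra].
  apply cos_eq_0_0 in Hc. destruct Hc as [k ->]. assert (P := PI_RGT_0).
  assert (K : INR n - 1 < IZR k < INR n + 1).
  { rewrite S_INR in Hx. split; nra. }
  assert (E : k = Z.of_nat n).
  { rewrite INR_IZR_INZ in K. destruct K as [K1 K2].
    rewrite <- minus_IZR in K1. rewrite <- plus_IZR in K2. apply lt_IZR in K1, K2. lia. }
  subst k. unfold center. rewrite INR_IZR_INZ. field.
Qed.

(** The hypothesis rules out exactly x = 0 in type D, where h = s^2 takes the value 1. *)
Lemma hW_lo (w : W) (n : nat) : qW w (lo n) <> 0 -> hW w (lo n) = 0.
Proof.
  assert (E : lo n * sR (lo n) ^ 2 = 0).
  { unfold lo. destruct (cR_sR_sqr (INR n * PI)) as [_ H]. rewrite sin_INR_PI in H.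
    replace ((INR n * PI) ^ 2) with (INR n * PI * (INR n * PI)) by ring.
    set (u := INR n * PI) in *.
    transitivity ((u * sR (u * u)) * (u * sR (u * u))); [ring|rewrite H; ring]. }
  destruct w; simpl qW; unfold hW; intros H; [exact E|].
  apply Rmult_integral in E. tauto.
Qed.

(** The competing open set is the outside of the closed strip together with h < y^2. It catches the
    edges too: at an edge point of the complement h = 0, so the gap is nonpositive, hence
    negative. *)
Lemma component_in_region (w : W) (n : nat) (c p : R * R) :
  region w n c -> component (complementX w) c p -> region w n p.
Proof.
  apply component_clopen with
    (V := fun p => (fst p < lo n \/ lo (S n) < fst p) \/ 0 < - gap w p).
  - apply open2_and; [apply open2_and; [apply open2_fst_gt|apply open2_fst_lt]|].
    apply open2_pos, gap_continuous.
  - apply open2_or; [apply open2_or; [apply open2_fst_lt|apply open2_fst_gt]|].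
    apply open2_pos. intros q eps He. destruct (gap_continuous w q eps He) as [r [Hr H]].
    exists r. split; [exact Hr|]. intros q' Hq'. specialize (H q' Hq').
    rewrite <- Rabs_Ropp. replace (- (- gap w q' - - gap w q)) with (gap w q' - gap w q) by ring.
    exact H.
  - intros q Hq. apply complementX_iff in Hq. destruct Hq as [Hq Hg].
    assert (Edge : forall m, fst q = lo m -> gap w q <= 0).
    { intros m E. unfold gap. rewrite E in *. rewrite hW_lo by exact Hq.
      assert (X := pow2_ge_0 (snd q)). lra. }
    unfold region, in_strip.
    destruct (Rtotal_order (fst q) (lo n)) as [H|[H|H]]; [right; auto| |].
    + right. right. specialize (Edge n H). lra.
    + destruct (Rtotal_order (fst q) (lo (S n))) as [H'|[H'|H']]; [| |right; auto].
      * destruct (Rlt_le_dec 0 (gap w q)); [now left|right; right; lra].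
      * right. right. specialize (Edge (S n) H'). lra.
  - unfold region, in_strip. intros q [H1 H2] H3. lra.
Qed.

Lemma region_complement (w : W) (n : nat) (p : R * R) : region w n p -> complementX w p.
Proof.
  intros [Hx Hg]. apply complementX_iff.
  assert (Q := qW_pos w _ (in_strip_pos _ _ Hx)). lra.
Qed.

Lemma Rmin_Rmax_sqr (y t : R) : Rmin y 0 <= t <= Rmax y 0 -> t ^ 2 <= y ^ 2.
Proof.
  unfold Rmin, Rmax. destruct (Rle_dec y 0); intros Ht; nra.
Qed.

Lemma strip_axis_region (w : W) (n : nat) (x : R) : in_strip n x -> region w n (x, 0).
Proof.
  intros Hx. split; [exact Hx|]. unfold gap. simpl fst. simpl snd.
  assert (H := hW_pos w x (in_strip_pos _ _ Hx) (in_strip_sR _ _ Hx)). lra.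
Qed.

(** A vertical segment to the axis decreases y^2 and so stays in the region; the axis inside the
    strip lies in the region because s has no zero there. *)
Lemma region_in_component (w : W) (n : nat) (c : R) (p : R * R) :
  in_strip n c -> region w n p -> component (complementX w) (c, 0) p.
Proof.
  destruct p as [x y]. intros Hc [Hx Hg]. simpl in Hx. apply component_sym.
  apply component_trans with (x, 0).
  - apply component_vertical. intros t Ht. apply Rmin_Rmax_sqr in Ht.
    apply region_complement with n. split; [exact Hx|].
    unfold gap in *. simpl fst in *. simpl snd in *. lra.
  - apply component_horizontal. intros t Ht.
    apply region_complement with n. apply strip_axis_region.
    unfold Rmin, Rmax, in_strip in *. destruct (Rle_dec x c); lra.
Qed.

Lemma component_strip (w : W) (n : nat) (c : R) (p : R * R) : in_strip n c ->
  (component (complementX w) (c, 0) p <-> region w n p).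
Proof.
  intros Hc. split; [|now apply region_in_component].
  apply component_in_region. now apply strip_axis_region.
Qed.

Lemma region_bounded (w : W) (n : nat) : bounded2 (region w n).
Proof.
  destruct (continuity_ab_maj (hW w) (lo n) (lo (S n))) as [m [Hm _]].
  { assert (H := center_strip n). unfold in_strip in H. lra. }
  { intros c _. apply continuity_pt_filterlim.
    apply (ex_derive_continuous (hW w)), ex_derive_hW. }
  (* Here y^2 is at most the maximum of h on the closed strip; the 1 turns a bound on y^2 into one
     on |y|. *)
  exists (lo (S n) + (1 + Rabs (hW w m))).
  intros [x y] [[H1 H2] Hg]. unfold gap in Hg. simpl in *.
  assert (L := lo_nonneg n). assert (A := Rle_abs (hW w m)). assert (B := Rabs_pos (hW w m)).
  specialize (Hm x ltac:(lra)).
  split; [rewrite Rabs_pos_eq; lra|].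
  assert (Y := Rabs_pos y). assert (Y2 := pow2_abs y). simpl in Y2. nra.
Qed.

Lemma bounded_component_meets_region (w : W) (p : R * R) : complementX w p ->
  bounded2 (component (complementX w) p) -> exists n, region w n p.
Proof.
  destruct p as [x y]. intros Hp [M HM]. apply complementX_iff in Hp. simpl fst in Hp.
  destruct Hp as [Hq Hg]. assert (A := Rle_abs M). assert (A' := Rabs_pos M).
  destruct (Rtotal_order (gap w (x, y)) 0) as [H|[H|H]]; [|contradiction|].
  - exfalso.
    assert (K : forall t, y ^ 2 <= t ^ 2 -> complementX w (x, t)).
    { intros t Ht. apply complementX_iff. split; [exact Hq|].
      unfold gap in *. simpl fst in *. simpl snd in *. lra. }
    (* The ray leads away from the axis, so y^2 grows and the gap stays negative; its length 1 + |M|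
       exceeds the supposed bound. *)
    destruct (Rle_dec 0 y) as [Hy|Hy].
    + assert (C : component (complementX w) (x, y) (x, y + (1 + Rabs M))).
      { apply component_vertical. rewrite Rmin_left, Rmax_right by lra.
        intros t Ht. apply K. nra. }
      apply HM in C. simpl in C. destruct C as [_ C]. rewrite Rabs_pos_eq in C; lra.
    + assert (C : component (complementX w) (x, y) (x, y - (1 + Rabs M))).
      { apply component_vertical. rewrite Rmin_right, Rmax_left by lra.
        intros t Ht. apply K. nra. }
      apply HM in C. simpl in C. destruct C as [_ C]. rewrite Rabs_left in C; lra.
  - assert (Hh : 0 < hW w x).
    { unfold gap in H. simpl fst in H. simpl snd in H. assert (Y := pow2_ge_0 y). lra. }
    destruct (Rlt_le_dec 0 x) as [Hx|Hx].
    + destruct (strip_exists x Hx) as [n Hn].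
      { intros E. destruct w; unfold hW in Hh; rewrite E in Hh; lra. }
      exists n. now split.
    (* In type A, h = x s^2 cannot be positive for x <= 0. In type D, x < 0 and s is positive on the
       negative half-axis, which therefore lies in the complement. *)
    + exfalso. destruct w; unfold hW in Hh.
      { assert (X := pow2_ge_0 (sR x)). nra. }
      simpl in Hq.
      assert (C : component (complementX W_D) (x, y) (x - (1 + Rabs M), 0)).
      { apply component_trans with (x, 0).
        - apply component_vertical. intros t Ht. apply Rmin_Rmax_sqr in Ht.
          apply complementX_iff. split; [exact Hq|].
          unfold gap in *. simpl fst in *. simpl snd in *. lra.
        - apply component_horizontal. rewrite Rmin_right, Rmax_left by lra.
          intros t Ht. apply complementX_iff. simpl. split; [lra|].
          unfold gap. simpl. assert (Z := sR_pos_of_nonpos t ltac:(lra)). nra. }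
      apply HM in C. simpl in C. destruct C as [C _]. rewrite Rabs_left in C; lra.
Qed.

(** * Critical points of value 1 and the bounded components *)

Lemma critical_value_1 (w : W) (x y : C) : critical w x y -> fW w x y = RtoC 1 ->
  exists n, x = RtoC (center n) /\ y = RtoC 0.
Proof.
  intros Hc Hf. apply critical_type in Hc. destruct Hc as [a [b [-> [-> Hc]]]].
  rewrite fW_RtoC in Hf. apply RtoC_inj in Hf.
  apply (fR_crit w a b Hc) in Hf. destruct Hf as [-> [Ha Hca]].
  destruct (strip_exists a Ha) as [n Hn].
  { intros E. assert (P := pythagoras a Ha). rewrite E, Hca in P. lra. }
  exists n. split; [f_equal; now apply strip_cR_zero|reflexivity].
Qed.

Lemma critical_center (w : W) (n : nat) :
  critical w (RtoC (center n)) (RtoC 0) /\ fW w (RtoC (center n)) (RtoC 0) = RtoC 1.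
Proof.
  assert (P := in_strip_pos _ _ (center_strip n)).
  assert (K : crit_type w (center n) 0) by (apply crit_max; trivial; apply cR_center).
  split.
  - apply critical_type. exists (center n), 0. auto.
  - rewrite fW_RtoC. f_equal. apply (fR_crit _ _ _ K). split; [reflexivity|].
    split; [exact P|apply cR_center].
Qed.

Theorem theorem2 (w : W) :
  (* (i) C_W is contained in R^2 *)
  (forall x y : C, critical w x y -> Im x = 0 /\ Im y = 0) /\
  (* (ii) Hessian of f_W|_{R^2} at critical points *)
  (forall x y : C, critical w x y ->
     hess_nondegenerate w (Re x) (Re y) /\
     (fW w x y = RtoC 0 -> hess_indefinite w (Re x) (Re y)) /\
     (fW w x y = RtoC 1 -> hess_negdef w (Re x) (Re y))) /\
  (* (iii-a) C_{W,0} is exactly the set of nodes of X_{W,0,R} *)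
  (forall p : R * R,
     is_node (XR w) p <->
     exists x y : C, critical w x y /\ fW w x y = RtoC 0 /\
                     x = RtoC (fst p) /\ y = RtoC (snd p)) /\
  (* (iii-b) c |-> B_c is a bijection C_{W,1} -> bounded components *)
  ((forall x y : C, critical w x y -> fW w x y = RtoC 1 ->
      complementX w (Re x, Re y) /\
      bounded_component w (component (complementX w) (Re x, Re y))) /\
   (forall x y x' y' : C,
      critical w x y -> fW w x y = RtoC 1 ->
      critical w x' y' -> fW w x' y' = RtoC 1 ->
      set_eq (component (complementX w) (Re x, Re y))
             (component (complementX w) (Re x', Re y')) ->
      x = x' /\ y = y') /\
   (forall B, bounded_component w B ->
      exists x y : C, critical w x y /\ fW w x y = RtoC 1 /\
        set_eq B (component (complementX w) (Re x, Re y)))).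
Proof.
  split; [|split; [|split; [|split; [|split]]]].
  - intros x y H. apply critical_type in H. destruct H as [a [b [-> [-> _]]]]. now split.
  - intros x y H. apply critical_type in H. destruct H as [a [b [-> [-> H]]]].
    change (Re (RtoC a)) with a. change (Re (RtoC b)) with b. rewrite fW_RtoC.
    destruct (hessian_critical w a b H) as [H1 [H2 H3]].
    split; [exact H1|]. split; intros E; apply RtoC_inj in E; auto.
  - apply node_iff.
  - intros x y Hc Hf. destruct (critical_value_1 w x y Hc Hf) as [n [-> ->]].
    change (Re (RtoC (center n))) with (center n). change (Re (RtoC 0)) with 0.
    assert (S := center_strip n).
    assert (K := region_complement w n _ (strip_axis_region w n _ S)).
    split; [exact K|]. split; [now exists (center n, 0)|].
    destruct (region_bounded w n) as [M HM]. exists M. intros p Hp.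
    apply HM. revert Hp. now apply component_strip.
  - intros x y x' y' Hc Hf Hc' Hf' E.
    destruct (critical_value_1 w x y Hc Hf) as [n [-> ->]].
    destruct (critical_value_1 w x' y' Hc' Hf') as [n' [-> ->]].
    change (Re (RtoC (center n))) with (center n) in E.
    change (Re (RtoC (center n'))) with (center n') in E. change (Re (RtoC 0)) with 0 in E.
    assert (R' := region_complement w n' _ (strip_axis_region w n' _ (center_strip n'))).
    (* The second center lies in its own component, hence in the region of the first; each strip
       contains only one zero of c. *)
    apply component_refl, E, (component_strip w n _ _ (center_strip n)) in R'.
    destruct R' as [R' _]. split; [|reflexivity].
    f_equal. symmetry. apply strip_cR_zero; [exact R'|apply cR_center].
  - intros B [[c [Hc HB]] [M HM]].
    destruct (bounded_component_meets_region w c Hc) as [n Hn].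
    { exists M. intros p Hp. apply HM, HB, Hp. }
    exists (RtoC (center n)), (RtoC 0).
    destruct (critical_center w n) as [K1 K2].
    split; [exact K1|]. split; [exact K2|].
    change (Re (RtoC (center n))) with (center n). change (Re (RtoC 0)) with 0.
    (* The base point of the given component is joined to the center of its region, so the two
       components coincide. *)
    assert (L := region_in_component w n _ c (center_strip n) Hn).
    intros p. rewrite (HB p). split; intros Hp.
    + now apply component_trans with c.
    + apply component_trans with (center n, 0); [now apply component_sym|exact Hp].
Qed.
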